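(* Let $h_1,\dots,h_n:\mathbb R^p\times\mathcal Z\to\mathbb R$, and assume that (H1)--(H3) and (D1)--(D2) of the context hold for $h=h_i$, for each $i=1,\dots,n$. Let $H_i=\max_{z\in\mathcal Z}h_i(\cdot,z)$, $F=\frac1n\sum_{i=1}^nH_i$, and for $\beta>0$ let $F^\beta=\frac1n\sum_{i=1}^nH_i^\beta$ with $H_i^\beta(w)=\beta\log\mathbb E_{z\sim\pi_0}[e^{h_i(w,z)/\beta}]$. Then for every compact set $K\subset\mathbb R^p$, $$\mathbb D\big(\mathrm{Graph}_K\nabla F^\beta,\ \mathrm{Graph}_K\partial^cF\big)\longrightarrow0\qquad\text{as }\beta\to0^+.$$
   Context: $\mathcal Z$ is a Polish space, $\pi_0$ a Borel probability measure on $\mathcal Z$. Conditions on $h:\mathbb R^p\times\mathcal Z\to\mathbb R$: (H1) $\mathrm{supp}(\pi_0)=\mathcal Z$. (H2) $h$ is continuous on $\mathbb R^p\times\mathcal Z$. (H3) There exist $\eta>0$, a continuous coercive $\psi:\mathcal Z\to[0,\infty)$ (all sublevel sets compact) and a locally bounded $\kappa:\mathbb R^p\to[1,\infty)$ with $\int\psi^{1+\eta}d\pi_0<\infty$ and $h(w,z)\le-\kappa(w)\psi(z)$ for all $(w,z)$. (D1) For all $z$, $h(\cdot,z)$ is differentiable and its gradient $\nabla_wh$ in the first variable is jointly continuous. (D2) There exist $\eta>0$, a continuous $\Psi:\mathcal Z\to[0,\infty)$ and a locally bounded $C:\mathbb R^p\to[1,\infty)$ with $\int\Psi^{1+\eta}d\pi_0<\infty$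 and $\|\nabla_wh(w,z)\|\le C(w)\Psi(z)$ for all $(w,z)$. The Clarke subdifferential $\partial^cF(w)$ is the convex hull of all limits $\lim_k\nabla F(w_k)$ with $w_k\to w$ and $F$ differentiable at $w_k$. For a (single- or set-valued) map $D$, $\mathrm{Graph}_KD=\{(w,v):w\in K,\ v\in D(w)\}$. The excess distance is $\mathbb D(A,B)=\sup_{a\in A}\inf_{b\in B}\|a-b\|$ (Euclidean norm). *)

(* Defs.v *)
From HB Require Import structures.
From mathcomp Require Import all_boot all_order all_algebra.
From mathcomp Require Import all_classical all_reals all_analysis.
Set Implicit Arguments.
Unset Strict Implicit.
Unset Printing Implicit Defensive.
Import Order.TTheory GRing.Theory Num.Theory.
Import numFieldNormedType.Exports.
Local Open Scope classical_set_scope.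
Local Open Scope ring_scope.

(* The library's norm on 'rV[R]_m is the sup norm: it is used below only for
   its topology and for differentiability, which do not depend on the norm. *)
Definition enorm (R : realType) (m : nat) (x : 'rV[R]_m) : R :=
  Num.sqrt (\sum_(i < m) x ord0 i ^+ 2).

Definition grad (R : realType) (p : nat) (f : 'rV[R]_p -> R) (w : 'rV[R]_p) :
    'rV[R]_p :=
  \row_(i < p) 'D_(delta_mx ord0 i) f w.

(* Separable and completely metrizable; R only serves as the codomain of the
   metric. *)
Definition polish (R : realType) (Z : topologicalType) : Prop :=
  (exists2 D : set Z, countable D & dense D) /\
  exists dist : Z -> Z -> R,
    [/\ (forall x y, 0 <= dist x y) /\ (forall x y, dist x y = 0 <-> x = y),
        forall x y, dist x y = dist y x,
        forall x y z, dist x z <= dist x y + dist y z,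
        forall (x : Z) (U : set Z),
          nbhs x U <-> exists2 e : R, 0 < e & [set y | dist x y < e] `<=` U &
        forall u : nat -> Z,
          (forall e : R, 0 < e -> exists N, forall i j,
             (N <= i)%N -> (N <= j)%N -> dist (u i) (u j) < e) ->
          exists l : Z, u @ \oo --> l].

Notation borelType Z := (g_sigma_algebraType (@open Z)).

Definition topological_support (R : realType) (Z : ptopologicalType)
    (mu : probability (borelType Z) R) : set Z :=
  [set z | forall U : set Z, open U -> U z -> (0 < mu U)%E].

Definition locally_bounded (R : realType) (p : nat) (f : 'rV[R]_p -> R) :=
  forall w : 'rV[R]_p, bounded_near f (nbhs w).

Definition coercive (R : realType) (Z : topologicalType) (psi : Z -> R) :=
  forall r : R, compact [set z | psi z <= r].

Section conditions.
Variables (R : realType) (Z : ptopologicalType).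
Variable pi0 : probability (borelType Z) R.
Variables (p : nat) (h : 'rV[R]_p -> Z -> R).

Definition condH1 : Prop := topological_support pi0 = [set: Z].

Definition condH2 : Prop := continuous (fun x : 'rV[R]_p * Z => h x.1 x.2).

Definition condH3 : Prop :=
  exists (eta : R) (psi : Z -> R) (kappa : 'rV[R]_p -> R),
    [/\ 0 < eta,
        [/\ continuous psi, coercive psi & forall z, 0 <= psi z],
        locally_bounded kappa /\ (forall w, 1 <= kappa w),
        (\int[pi0]_z (psi z `^ (1 + eta))%:E < +oo)%E &
        forall w z, h w z <= - kappa w * psi z].

Definition condD1 : Prop :=
  (forall z w, differentiable (h ^~ z) w) /\
  continuous (fun x : 'rV[R]_p * Z => grad (h ^~ x.2) x.1).

Definition condD2 : Prop :=
  exists (eta : R) (Psi : Z -> R) (C : 'rV[R]_p -> R),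
    [/\ 0 < eta,
        continuous Psi /\ (forall z, 0 <= Psi z),
        locally_bounded C /\ (forall w, 1 <= C w),
        (\int[pi0]_z (Psi z `^ (1 + eta))%:E < +oo)%E &
        forall w z, enorm (grad (h ^~ z) w) <= C w * Psi z].

End conditions.

(* The greatest element of A; the default value 0 is returned when A has none. *)
Definition max_of (R : realType) (A : set R) : R :=
  xget 0 [set m | A m /\ ubound A m].

Definition hardmax (R : realType) (Z : Type) (p : nat)
    (h : 'rV[R]_p -> Z -> R) (w : 'rV[R]_p) : R :=
  max_of (range (h w)).

Definition softmax (R : realType) (Z : ptopologicalType)
    (pi0 : probability (borelType Z) R) (p : nat)
    (h : 'rV[R]_p -> Z -> R) (beta : R) (w : 'rV[R]_p) : R :=
  beta * ln (fine 'E_pi0[fun z => expR (h w z / beta)]).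

Definition average (R : realType) (n p : nat) (H : 'I_n -> 'rV[R]_p -> R)
    (w : 'rV[R]_p) : R :=
  n%:R^-1 * \sum_(i < n) H i w.

Definition convex_hull (R : realType) (p : nat) (A : set 'rV[R]_p) :
    set 'rV[R]_p :=
  smallest (@convex_set R 'rV[R]_p) A.

Definition clarke (R : realType) (p : nat) (F : 'rV[R]_p -> R)
    (w : 'rV[R]_p) : set 'rV[R]_p :=
  convex_hull [set v | exists u : nat -> 'rV[R]_p,
    [/\ u @ \oo --> w,
        forall k, differentiable F (u k) &
        grad F (u k) @[k --> \oo] --> v]].

(* The pair (w, v) of vectors of R^p is encoded as the vector row_mx w v of
   R^(p + p), so that the Euclidean norm of the product is enorm. *)
Definition graph_on (R : realType) (p : nat) (K : set 'rV[R]_p)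
    (D : 'rV[R]_p -> set 'rV[R]_p) : set 'rV[R]_(p + p) :=
  [set x | exists w v, [/\ K w, D w v & x = row_mx w v]].

(* Extended-real valued. Suprema are taken in [0, +oo], so that the excess of
   the empty set is 0; the infimum over an empty B is +oo. *)
Definition excess (R : realType) (m : nat) (A B : set 'rV[R]_m) : \bar R :=
  maxe 0%E (ereal_sup
    [set ereal_inf [set (enorm (a - b))%:E | b in B] | a in A]).

(* Main.v *)
Require Import Defs.
From HB Require Import structures.
From mathcomp Require Import all_boot all_order all_algebra.
From mathcomp Require Import all_classical all_reals all_analysis.
From mathcomp Require Import measurable_realfun.
From mathcomp Require Import ring lra.
Import Order.TTheory GRing.Theory Num.Theory.
Import numFieldNormedType.Exports.
Local Open Scope classical_set_scope.
Local Open Scope ring_scope.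
Set Implicit Arguments.
Unset Strict Implicit.
Unset Printing Implicit Defensive.

(* For the smoothed functions, the gradient of H_i^beta at w' is the mean of
   grad h_i(w', .) under the Gibbs measure of density proportional to
   exp(h_i(w', .) / beta), and Jensen's inequality for that measure gives,
   locally uniformly in w' and for beta small,
     H_i^beta(x) >= H_i^beta(w') + <grad H_i^beta(w'), x - w'> - e |x - w'|;
   the mass outside a sublevel set of psi is exponentially small. The function
   H_i satisfies the same inequality with the gradient of h_i(., z) at a
   maximizer z, so both inequalities pass to the averages. Given a direction d
   and a small t, the first one and F^beta -> F bound <grad F^beta(w'), d> from
   above by (F(w + t d) - F(w)) / t + e, while the second one bounds this
   quotient from above by <grad F(y), d> + e at any point y of
   differentiability close to w + t d. Such points are dense: no Rademacher
   theorem is needed, as F, which has approximate subgradients everywhere, is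
   differentiable wherever it is touched from above by a paraboloid. Letting
   t -> 0, every limit of gradients of F^beta lies below the support function
   of the Clarke subdifferential, and one concludes by separation and
   compactness. *)

(** * Inner product and differentials *)

Section dot.
Context {R : realType} {p : nat}.
Implicit Types (u v x y : 'rV[R]_p) (a : R).

Definition dot u v : R := \sum_(i < p) u ord0 i * v ord0 i.

Lemma dotC u v : dot u v = dot v u.
Proof. by apply: eq_bigr => i _; rewrite mulrC. Qed.

Lemma dot_is_linear u : linear_for *%R (dot u).
Proof.
move=> a x y; rewrite /dot mulr_sumr -big_split/=.
by apply: eq_bigr => i _; rewrite !mxE; ring.
Qed.

HB.instance Definition _ u :=
  GRing.isLinear.Build R 'rV[R]_p R *%R (dot u) (dot_is_linear u).

Lemma dotDr u x y : dot u (x + y) = dot u x + dot u y.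
Proof. exact: linearD. Qed.

Lemma dotBr u x y : dot u (x - y) = dot u x - dot u y.
Proof. exact: linearB. Qed.

Lemma dotNr u x : dot u (- x) = - dot u x.
Proof. exact: linearN. Qed.

Lemma dotZr a u x : dot u (a *: x) = a * dot u x.
Proof. exact: linearZ. Qed.

Lemma dotBl u x y : dot (x - y) u = dot x u - dot y u.
Proof. by rewrite dotC dotBr !(dotC u). Qed.

Lemma dotZl a u x : dot (a *: x) u = a * dot x u.
Proof. by rewrite dotC dotZr dotC. Qed.

Lemma dot0r u : dot u 0 = 0.
Proof. exact: linear0. Qed.

Lemma norm_coord u i : `|u ord0 i| <= `|u|.
Proof.
rewrite [`|u|]mx_normrE.
exact: (@le_bigmax _ _ _ 0 (fun j => `|u j.1 j.2|) (ord0, i)).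
Qed.

Lemma rV_norm_le a u : 0 <= a -> (forall i, `|u ord0 i| <= a) -> `|u| <= a.
Proof.
move=> a0 ua; rewrite [`|u|]mx_normrE; apply/bigmax_leP; split => //= -[i j] _
  /=.
by rewrite ord1.
Qed.

(** Both norms are sup norms, so a bound on each of the [p] terms replaces Cauchy-Schwarz; hence the
    factor [p] in later constants. *)
Lemma dot_le u v : `|dot u v| <= p%:R * `|u| * `|v|.
Proof.
apply: (le_trans (ler_norm_sum _ _ _)).
apply: (@le_trans _ _ (\sum_(i < p) `|u| * `|v|)).
  by apply: ler_sum => i _; rewrite normrM ler_pM// norm_coord.
by rewrite sumr_const card_ord -[leLHS]mulr_natl mulrA.
Qed.

Lemma dot_ge u v : - (p%:R * `|u| * `|v|) <= dot u v.
Proof. by have := dot_le u v; rewrite ler_norml => /andP[]. Qed.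

Lemma dot_leW u v : dot u v <= p%:R * `|u| * `|v|.
Proof. exact: le_trans (ler_norm _) (dot_le u v). Qed.

Lemma dot_sqr_ge0 u : 0 <= dot u u.
Proof. by apply: sumr_ge0 => i _; rewrite -expr2 sqr_ge0. Qed.

Lemma dot_sqr_coord u i : u ord0 i ^+ 2 <= dot u u.
Proof.
rewrite /dot (bigD1 i)//= expr2 lerDl; apply: sumr_ge0 => j _.
by rewrite -expr2 sqr_ge0.
Qed.

Lemma norm_sqr_le_dot u : `|u| ^+ 2 <= dot u u.
Proof.
rewrite -[leRHS]sqr_sqrtr ?dot_sqr_ge0// lerXn2r ?nnegrE//.
apply: rV_norm_le => // i; rewrite -sqrtr_sqr ler_wsqrtr//.
exact: dot_sqr_coord.
Qed.

Lemma enormE u : enorm u = Num.sqrt (dot u u).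
Proof. by congr Num.sqrt; apply: eq_bigr => i _; rewrite expr2. Qed.

Lemma norm_le_enorm u : `|u| <= enorm u.
Proof.
rewrite enormE -(sqr_sqrtr (dot_sqr_ge0 u)).
rewrite sqrtr_sqr ger0_norm//.
rewrite -[`|u|]ger0_norm// -sqrtr_sqr ler_wsqrtr//.
exact: norm_sqr_le_dot.
Qed.

Lemma dot_sqr_eq0 u : dot u u <= 0 -> u = 0.
Proof.
move=> u0; apply/eqP; rewrite -normr_eq0 -sqrf_eq0 eq_le sqr_ge0 andbT.
exact: le_trans (norm_sqr_le_dot u) u0.
Qed.

Lemma dot_delta u i : dot u (delta_mx ord0 i) = u ord0 i.
Proof.
rewrite /dot (bigD1 i)//= big1 ?addr0 => [|j /negPf ji].
  by rewrite mxE !eqxx mulr1.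
by rewrite mxE eqxx ji mulr0.
Qed.

Lemma dot_continuous u : continuous (dot u).
Proof.
apply: bounded_linear_continuous.
apply/linear_boundedP; near=> M.
by move=> x; apply: le_trans (dot_le u x) _; rewrite ler_wpM2r.
Unshelve. all: by end_near. Qed.

Lemma dot_sqr_continuous y : continuous (fun x => dot (x - y) (x - y)).
Proof.
apply: (@continuous_big R _ +%R _ _ _ 'rV[R]_p) => [|i _ x].
  exact: add_continuous.
have c : {for x, continuous (fun z : 'rV[R]_p => (z - y) ord0 i)}.
  have -> : (fun z : 'rV[R]_p => (z - y) ord0 i) =
            (fun z => dot (delta_mx ord0 i) z - y ord0 i).
    by apply/funext => z; rewrite dotC dot_delta !mxE.
  by apply: continuousB; [exact: dot_continuous|exact: cst_continuous].
by apply: continuousM; exact: c.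
Qed.

End dot.

Section differential.
Context {R : realType} {p : nat}.
Implicit Types (f : 'rV[R]_p -> R) (w x y q : 'rV[R]_p).

(** Uniqueness of the differential identifies it with [dot q], and its values on the coordinate
    vectors give the gradient. This serves at points where a function is squeezed between two smooth
    bounds. *)
Lemma differentiable_of_expansion f y q :
  (forall e, 0 < e ->
    \forall x \near y, `|f x - f y - dot q (x - y)| <= e * `|x - y|) ->
  differentiable f y /\ grad f y = q.
Proof.
move=> fq.
have dq : (f : 'rV[R]_p -> R^o) \o shift y =
    cst (f y : R^o) + (dot q : 'rV[R]_p -> R^o) +o_ (0 : 'rV[R]_p) id.
  apply/eqaddoP => e e0; have := fq e e0.
  rewrite (near_shift 0)/= => /filterS; apply => x /=.
  rewrite subr0 addrK fctE/=.
  by rewrite opprD addrA.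
have dE : 'd f y = dot q :> (_ -> _).
  by apply: diff_unique => //; exact: dot_continuous.
have df : differentiable f y.
  apply/diff_locallyP; rewrite dE; split; last exact: dq.
  exact: dot_continuous.
split => //; apply/rowP => i; rewrite mxE deriveE// dE.
by rewrite dot_delta.
Qed.

Lemma grad_dot f y d : differentiable f y -> 'D_d f y = dot (grad f y) d.
Proof.
move=> df; rewrite deriveE// {1}(row_sum_delta d) linear_sum/=.
apply: eq_bigr => i _; rewrite linearZ/= mulrC; congr *%R.
by rewrite mxE deriveE.
Qed.

End differential.

(** * Approximate subgradients *)

(** For [e = 0] this is the subgradient inequality of a convex function, restricted to a ball. The
    slack proportional to [|x - y|], uniform in both points, makes it available for maxima of C^1
    functions, and averaging preserves it. *)
Definition approx_subgrad (R : realType) (p : nat) (f : 'rV[R]_p -> R)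
    (g : 'rV[R]_p -> 'rV[R]_p) (w : 'rV[R]_p) (r e : R) :=
  forall x y, `|x - w| < r -> `|y - w| < r ->
    f y + dot (g y) (x - y) - e * `|x - y| <= f x.

Lemma near_norm_lt (R : realType) (p : nat) (w : 'rV[R]_p) (r : R) :
  0 < r -> \forall y \near w, `|y - w| < r.
Proof.
move=> r0; apply/nbhs_normP; exists r => //= y.
by rewrite /ball_/= distrC.
Qed.

Lemma near_norm_ltP (R : realType) (p : nat) (w : 'rV[R]_p) (P : set 'rV[R]_p) :
  (\forall y \near w, P y) -> exists2 r, 0 < r & forall y, `|y - w| < r -> P y.
Proof.
move=> /nbhs_normP[r /= r0 rP]; exists r => // y yw; apply: rP.
by rewrite /ball_/= distrC.
Qed.

Lemma compact_norm_ball (R : realType) (p : nat) (w : 'rV[R]_p) (r : R) :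
  compact [set y : 'rV[R]_p | `|y - w| <= r].
Proof.
apply: bounded_closed_compact.
  exists (`|w| + r); split; first exact: num_real.
  move=> M wM y /= yw; apply: (le_trans _ (ltW wM)).
  by rewrite -[y](subrK w) (le_trans (ler_normD _ _))// addrC lerD2l.
rewrite (_ : mkset _ = closed_ball_ Num.norm w r); first exact:
  closed_closed_ball_.
by apply/seteqP; split => y /=; rewrite /closed_ball_/= distrC.
Qed.

Section approx_subgradient.
Context {R : realType} {p : nat}.
Implicit Types (w x y u v : 'rV[R]_p) (r e d : R).
Variables (F : 'rV[R]_p -> R) (G : 'rV[R]_p -> 'rV[R]_p).
Hypothesis G_bounded : forall w : 'rV[R]_p, exists L, \forall y \near w, `|G y|
  <= L.
Hypothesis G_subgrad : forall w e, 0 < e ->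
  exists2 r, 0 < r & approx_subgrad F G w r e.

(** The inequality with slack 1, used once from [y] to [x] and once from [x] to [y], bounds the
    difference on both sides. *)
Lemma approx_subgrad_lipschitz w : exists K r,
  [/\ 0 <= K, 0 < r & forall x y, `|x - w| < r -> `|y - w| < r ->
    `|F x - F y| <= K * `|x - y|].
Proof.
have [L /near_norm_ltP[r1 r10 GL]] := G_bounded w.
have [r2 r20 GF] := G_subgrad w ltr01.
have L0 : 0 <= L by rewrite (le_trans _ (GL w _))// subrr normr0.
exists (p%:R * L + 1), (Num.min r1 r2); split.
- by rewrite addr_ge0// mulr_ge0.
- by rewrite lt_min r10.
suff H x y : `|x - w| < Num.min r1 r2 -> `|y - w| < Num.min r1 r2 ->
    F y - F x <= (p%:R * L + 1) * `|x - y|.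
  move=> x y xw yw; rewrite ler_norml; apply/andP; split.
    by have := H x y xw yw; lra.
  by have := H y x yw xw; rewrite distrC.
rewrite !lt_min => /andP[xw1 xw2] /andP[yw1 yw2].
have := GF x y xw2 yw2; have := dot_ge (G y) (x - y).
have : p%:R * `|G y| * `|x - y| <= p%:R * L * `|x - y|.
  by rewrite ler_wpM2r// ler_wpM2l// GL.
lra.
Qed.

Lemma approx_subgrad_continuous : continuous F.
Proof.
move=> w; have [K [r [K0 r0 FK]]] := approx_subgrad_lipschitz w.
apply/(@cvgrPdist_lt _ _ _ (nbhs w)) => e e0.
have d0 : 0 < Num.min r (e / (K + 1)) by rewrite lt_min r0 divr_gt0// ltr_wpDl.
near=> y.
have : `|y - w| < Num.min r (e / (K + 1)) by near: y; exact: near_norm_lt.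
rewrite lt_min => /andP[yr]; rewrite ltr_pdivlMr ?ltr_wpDl// => ye.
apply: le_lt_trans (FK w y _ _) _ => //; first by rewrite subrr normr0.
rewrite distrC; apply: le_lt_trans ye; have := normr_ge0 (y - w); lra.
Unshelve. all: by end_near. Qed.

(* At a maximizer of F - M |. - x0|^2 the function F is touched from above by a
   smooth function and from below by its approximate subgradient. *)
Lemma differentiable_dense (x0 : 'rV[R]_p) d : 0 < d ->
  exists2 y, `|y - x0| < d & differentiable F y /\ grad F y = G y.
Proof.
move=> d0; have [K [r [K0 r0 FK]]] := approx_subgrad_lipschitz x0.
pose rho := Num.min (d / 2) (r / 2).
have rho0 : 0 < rho by rewrite lt_min !divr_gt0.
have rhod : rho < d by rewrite gt_min; apply/orP; left; lra.
have rhor : rho < r by rewrite gt_min; apply/orP; right; lra.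
(* [M rho^2 = (K + 1) rho] exceeds the increase of [F] from [x0] to the sphere of radius [rho], at
   most [K rho], so the penalty keeps the maximizer of [f] inside the ball. *)
pose M := (K + 1) / rho.
have M0 : 0 < M by rewrite divr_gt0// ltr_wpDl.
pose f y := F y - M * dot (y - x0) (y - x0).
have cf : continuous f.
  move=> y; apply: (@continuousB R R 'rV[R]_p F).
    exact: approx_subgrad_continuous.
  apply: (@continuousM R 'rV[R]_p (cst M)); first exact: cst_continuous.
  exact: dot_sqr_continuous.
pose A := [set y : 'rV[R]_p | `|y - x0| <= rho].
have cA : compact A by exact: compact_norm_ball.
have Ax0 : A x0 by rewrite /A/= subrr normr0 ltW.
have [y yA ymax] := @EVT_max_rV R p f A (ex_intro _ x0 Ax0) cA
  (continuous_subspaceT cf).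
move: yA; rewrite inE /A/= => yA.
have {}ymax t : `|t - x0| <= rho -> f t <= f y.
  by move=> tA; apply: ymax; rewrite inE.
have ylt : `|y - x0| < rho.
  rewrite lt_neqAle yA andbT; apply/eqP => yrho.
  have := ymax x0; rewrite subrr normr0 ltW// => /(_ isT).
  rewrite /f subrr dot0r mulr0 subr0.
  have := FK y x0; rewrite subrr normr0 yrho => /(_ rhor r0).
  have : M * rho ^+ 2 <= M * dot (y - x0) (y - x0).
    by rewrite ler_pM2l// -{1}yrho norm_sqr_le_dot.
  have -> : M * rho ^+ 2 = K * rho + rho by rewrite /M; field; rewrite gt_eqF.
  rewrite ler_norml => ? /andP[_ ?]; lra.
exists y; first exact: lt_trans rhod.
pose q := (2 * M) *: (y - x0).
(* Expanding the square about [y] turns maximality into a quadratic upper bound with slope [q] at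
   [y]. *)
have up x : `|x - x0| <= rho ->
    F x <= F y + dot q (x - y) + M * dot (x - y) (x - y).
  move=> /ymax; rewrite /f.
  have -> : dot (x - x0) (x - x0) = dot (y - x0) (y - x0) +
      2 * dot (y - x0) (x - y) + dot (x - y) (x - y).
    by rewrite !(dotBl, dotBr) (dotC x y) (dotC x0 y) (dotC x0 x); ring.
  rewrite dotZl; lra.
have nearA : \forall x \near y, `|x - x0| <= rho.
  have : \forall x \near y, `|x - y| < rho - `|y - x0|.
    by apply: near_norm_lt; rewrite subr_gt0.
  apply: filterS => x; rewrite ltrBrDr => /ltW; apply: le_trans.
  by rewrite -[x - x0](subrKA y) ler_normD.
have low e : 0 < e -> \forall x \near y,
    F y + dot (G y) (x - y) - e * `|x - y| <= F x.
  move=> /(G_subgrad y)[s s0 sG].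
  near=> x; apply: sG; last by rewrite subrr normr0.
  by near: x; exact: near_norm_lt.
(* Along [y + t u] the two bounds give [t <G y - q, u> <= t^2 c + t e / 2]. The choice of [t] makes
   [t c <= e / 2], and [e] is arbitrary. *)
have dqG u : dot (G y - q) u <= 0.
  have [->|u0] := eqVneq u 0; first by rewrite dot0r.
  apply/ler_addgt0Pr => e e0; rewrite add0r.
  have un : 0 < `|u| by rewrite normr_gt0.
  have e2 : 0 < e / 2 / `|u| by rewrite !divr_gt0.
  have /near_norm_ltP[s s0 sP] : \forall x \near y, `|x - x0| <= rho /\
      F y + dot (G y) (x - y) - e / 2 / `|u| * `|x - y| <= F x.
    by apply: filterI nearA _; exact: low.
  pose c := M * dot u u.
  have c0 : 0 <= c by rewrite mulr_ge0 ?dot_sqr_ge0// ltW.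
  pose t := Num.min (s / 2 / `|u|) (e / 2 / (c + 1)).
  have t0 : 0 < t by rewrite lt_min !divr_gt0// ltr_wpDl.
  have := sP (y + t *: u); rewrite [y + _]addrC addrK normrZ gtr0_norm//.
  have /[swap]/[apply] : t * `|u| < s.
    rewrite -ltr_pdivlMr// gt_min; apply/orP; left.
    by rewrite ltr_pM2r ?invr_gt0//; lra.
  move=> -[/up]; rewrite !addrK !dotZr [dot (t *: u) u]dotZl => h1.
  move=> h2.
  have tc : t * c <= e / 2.
    apply: (@le_trans _ _ (e / 2 / (c + 1) * c)).
      by rewrite ler_wpM2r// ge_min lexx orbT.
    rewrite mulrAC ler_pdivrMr ?ltr_wpDl// ler_wpM2l//; lra.
  rewrite -(ler_pM2l t0) dotBl.
  have : t * (t * c) <= t * (e / 2) by rewrite ler_pM2l.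
  have : e / 2 / `|u| * (t * `|u|) = t * (e / 2) by field; rewrite gt_eqF.
  move: h1 h2; rewrite /c; lra.
(* The direction [u = G y - q] forces equality; the two bounds then squeeze [F] to first order. *)
have Gq : G y = q by apply/subr0_eq/dot_sqr_eq0/dqG.
rewrite Gq; apply: differentiable_of_expansion => e e0.
have c0 : 0 < M * p%:R + 1 by rewrite ltr_wpDl// mulr_ge0// ltW.
have e1 : 0 < e / (M * p%:R + 1) by rewrite divr_gt0.
have xs : \forall x \near y, `|x - y| < e / (M * p%:R + 1) by exact:
  near_norm_lt.
near=> x.
have : F x <= F y + dot q (x - y) + M * dot (x - y) (x - y).
  by apply: up; near: x.
have : F y + dot (G y) (x - y) - e * `|x - y| <= F x by near: x; exact: low.
have : `|x - y| < e / (M * p%:R + 1) by near: x.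
rewrite ltr_pdivlMr// Gq => xye h1 h2.
have n0 := normr_ge0 (x - y).
have : M * dot (x - y) (x - y) <= M * (p%:R * `|x - y| * `|x - y|).
  by rewrite ler_pM2l// dot_leW.
have : `|x - y| * (`|x - y| * (M * p%:R + 1)) <= `|x - y| * e.
  by rewrite ler_wpM2l// ltW.
rewrite ler_norml => h3 h4; apply/andP; split; first lra.
have := sqr_ge0 `|x - y|; rewrite expr2; lra.
Unshelve. all: by end_near. Qed.

End approx_subgradient.

(** * Smoothings of a function with approximate subgradients *)

Lemma near_prodl (T U : Type) (F : set_system T) (G : set_system U)
    {FG : Filter G} (P : T -> Prop) :
  (\forall x \near F, P x) -> \forall x \near F & y \near G, P x.
Proof.
move=> FP; exists (P, setT) => /=; first by split => //; exact: filterT.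
by move=> [x y] [].
Qed.

Lemma near_prodr (T U : Type) (F : set_system T) (G : set_system U)
    {FF : Filter F} (P : U -> Prop) :
  (\forall y \near G, P y) -> \forall x \near F & y \near G, P y.
Proof.
move=> GP; exists (setT, P) => /=; first by split => //; exact: filterT.
by move=> [x y] [].
Qed.

(** As [C] may fail to be closed, an almost nearest point [c0] replaces the projection of [v].
    Comparing [c0] with points of the segment towards [c] shows that [v - c0] separates, at the cost
    of half of [e]. *)
Lemma strict_separation (R : realType) (p : nat) (C : set 'rV[R]_p)
    (L e : R) (v : 'rV[R]_p) :
  C !=set0 -> 0 < e -> (forall c, C c -> `|c| <= L) ->
  (forall x y t, C x -> C y -> 0 <= t <= 1 -> C (t *: x + (1 - t) *: y)) ->
  (forall c, C c -> e <= dot (v - c) (v - c)) ->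
  exists d, forall c, C c -> dot d c + e / 2 <= dot d v.
Proof.
move=> [c1 Cc1] e0 CL convC Ce.
pose S := [set dot (v - c) (v - c) | c in C].
have hS : has_inf S.
  by split; [exists (dot (v - c1) (v - c1)), c1|exists e => _ [c /Ce ce <-]].
have L0 : 0 <= L by exact: le_trans (normr_ge0 _) (CL _ Cc1).
pose B := p%:R * (2 * L) * (2 * L) + 1.
have B0 : 0 < B by rewrite ltr_wpDl// !mulr_ge0.
(* [B] bounds [|c - c0|^2], so the second-order term [s^2 |c - c0|^2] is at most [s e / 2]; [c0] is
   taken within [s e / 2] of the infimum. Dividing by [s] leaves an error [e]. *)
pose s := Num.min 1 (e / 2 / B).
have s0 : 0 < s by rewrite lt_min ltr01 !divr_gt0.
have s1 : s <= 1 by rewrite ge_min lexx.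
have sB : s * B <= e / 2 by rewrite -ler_pdivlMr// ge_min lexx orbT.
have se0 : 0 < s * (e / 2) by rewrite mulr_gt0// divr_gt0.
have [_ [c0 Cc0 <-] c0inf] := inf_adherent se0 hS.
exists (v - c0) => c Cc.
have Cs := convC _ _ s Cc Cc0.
have : inf S <= dot (v - (s *: c + (1 - s) *: c0)) (v - (s *: c + (1 - s) *:
  c0)).
  apply: ge_inf; first by case: hS.
  by exists (s *: c + (1 - s) *: c0) => //; apply: Cs; rewrite s1 ltW.
have -> : v - (s *: c + (1 - s) *: c0) = (v - c0) - s *: (c - c0).
  by apply/rowP => i; rewrite !mxE; ring.
rewrite dotBr !(dotBl, dotZr, dotZl) => h1.
have cB : dot (c - c0) (c - c0) <= B.
  have : `|c - c0| <= 2 * L.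
    by have := ler_normB c c0; have := CL _ Cc; have := CL _ Cc0; lra.
  move=> cc; rewrite (le_trans (dot_leW _ _))// (@le_trans _ _ (p%:R * (2 * L)
    * (2 * L)))//.
    by rewrite ler_pM// ?mulr_ge0// ler_wpM2l.
  by rewrite lerDl.
have sscB : s * (s * dot (c - c0) (c - c0)) <= s * (e / 2).
  by rewrite ler_pM2l// (le_trans _ sB)// ler_pM2l.
have e1 := Ce _ Cc0.
have : 2 * dot (v - c0) (c - c0) <= e.
  rewrite -(ler_pM2l s0); move: h1 c0inf sscB.
  rewrite !(dotBl, dotBr) (dotC c0 v) (dotC c v) (dotC c c0); lra.
move: e1; rewrite !(dotBl, dotBr) (dotC c0 v) ; lra.
Qed.

Lemma convex_hull_conv (R : realType) (p : nat) (A : set 'rV[R]_p) x y (t : R) :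
  convex_hull A x -> convex_hull A y -> 0 <= t <= 1 ->
  convex_hull A (t *: x + (1 - t) *: y).
Proof.
move=> Ax Ay /andP[t0 t1] B [cB AB].
have Bx : B x by apply: Ax.
have By : B y by apply: Ay.
have := cB x y (Itv01 t0 t1); rewrite !inE; exact.
Qed.

(** * Limits of gradients of a family of smoothings *)

Section smoothing.
Context {R : realType} {p : nat}.
Implicit Types (w x y u v d : 'rV[R]_p) (r e b : R).
Variables (F : 'rV[R]_p -> R) (G : 'rV[R]_p -> 'rV[R]_p).
Hypothesis G_bounded : forall w, exists L, \forall y \near w, `|G y| <= L.
Hypothesis G_subgrad : forall w e, 0 < e ->
  exists2 r, 0 < r & approx_subgrad F G w r e.
Variable Fs : R -> 'rV[R]_p -> R.
Hypothesis Fs_bounded : forall w, exists L,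
  \forall y \near w & b \near 0^'+, `|grad (Fs b) y| <= L.
Hypothesis Fs_subgrad : forall w e, 0 < e ->
  exists2 r, 0 < r &
    \forall b \near 0^'+, approx_subgrad (Fs b) (grad (Fs b)) w r e.
Hypothesis Fs_le : forall b x, 0 < b -> Fs b x <= F x.
Hypothesis Fs_ge : forall w e, 0 < e ->
  \forall y \near w & b \near 0^'+, F w - e <= Fs b y.

(* Both sides are compared with (F (w + t d) - F w) / t for a small t. *)
Lemma grad_smoothing_le_grad w d e : 0 < e ->
  exists y, [/\ `|y - w| < e, differentiable F y, `|grad F y| <= sval (cid
    (G_bounded w)) &
    \forall z \near w & b \near 0^'+, dot (grad (Fs b) z) d <= dot (grad F y) d
      + e].
Proof.
(* The bound on [grad F y] is the witness chosen from [G_bounded w], so it is independent of [d] and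
   [e]; the compactness arguments that follow need one radius for all of them. *)
case: cid => L GL /= e0.
have [L2 FsL] := Fs_bounded w.
have [K [r0 [K0 r00 FK]]] := approx_subgrad_lipschitz G_bounded G_subgrad w.
have /near_norm_ltP[rL rL0 {}GL] := GL.
have L0 : 0 <= L by rewrite (le_trans _ (GL w _))// subrr normr0.
pose D := `|d| + 1.
have D0 : 0 < D by rewrite ltr_wpDl.
(* [B] collects the errors of relative size [a]: 1 for [Fs_ge], [p L] and [K] for replacing
   [w + t d] by [y], [p |L2|] for replacing [w] by [z]. With [a B <= e / 2] and two slacks
   [e1 D = e / 4], the total is at most [e]. *)
pose B := 1 + p%:R * L + K + p%:R * `|L2|.
have B0 : 0 < B by rewrite /B -!addrA ltr_pwDl// !addr_ge0// mulr_ge0.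
pose e1 := e / 4 / D.
have e10 : 0 < e1 by rewrite !divr_gt0.
have [r1 r10 Gr] := G_subgrad w e10.
have [r2 r20 Fr] := Fs_subgrad w e10.
pose a := Num.min 1 (e / 2 / B).
have a0 : 0 < a by rewrite lt_min ltr01 !divr_gt0.
have a1 : a <= 1 by rewrite ge_min lexx.
have aB : a * B <= e / 2.
  by rewrite -ler_pdivlMr// ge_min lexx orbT.
pose r := Num.min (Num.min r0 rL) (Num.min (Num.min r1 r2) e).
have r_gt0 : 0 < r by rewrite !lt_min r00 rL0 r10 r20 e0.
(* Since [a <= 1] and [D = |d| + 1], the points within [t a] of [w] or of [w + t d] lie within
   [t D < r] of [w], hence in all the balls above. *)
pose t := r / 2 / D.
have t0 : 0 < t by rewrite !divr_gt0.
have tD : t * D < r by rewrite divfK ?gt_eqF//; lra.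
have ta0 : 0 < t * a by rewrite mulr_gt0.
have taD : t * `|d| + t * a <= t * D.
  by rewrite -mulrDr ler_pM2l// lerD2l.
pose x := w + t *: d.
have xw : `|x - w| <= t * `|d|.
  by rewrite /x addrC addKr normrZ gtr0_norm.
have [y yx [dF gF]] := differentiable_dense G_bounded G_subgrad x ta0.
have yw : `|y - w| < t * D.
  apply: lt_le_trans taD; rewrite -[y - w](subrKA x).
  by rewrite (le_lt_trans (ler_normD _ _))// addrC ler_ltD.
have [/andP[/andP[ry0 ryL] /andP[/andP[ry1 ry2] rye]]] :
    [&& (`|y - w| < r0) && (`|y - w| < rL) &
     ((`|y - w| < r1) && (`|y - w| < r2)) && (`|y - w| < e)].
  by rewrite -!lt_min (lt_trans yw).
have [/andP[/andP[rx0 rxL] /andP[/andP[rx1 rx2] rxe]]] :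
    [&& (`|x - w| < r0) && (`|x - w| < rL) &
     ((`|x - w| < r1) && (`|x - w| < r2)) && (`|x - w| < e)].
  by rewrite -!lt_min (le_lt_trans xw)// (le_lt_trans _ tD)// (le_trans _
    taD)// lerDl ltW.
exists y; split => //; first by rewrite gF GL.
(* The inequality for [F] based at [y] and tested at [w] bounds the difference quotient from above
   by the slope at [y]. *)
have Gy : (F x - F w) - t * (e1 * D + a * (p%:R * L + K)) <= t * dot (G y) d.
  have := Gr w y; rewrite subrr normr0 => /(_ r10 ry1).
  have -> : dot (G y) (w - y) = - (t * dot (G y) d + dot (G y) (y - x)).
    rewrite -dotZr -dotDr -dotNr; congr dot; rewrite /x.
    by apply/rowP => i; rewrite !mxE; ring.
  have := dot_leW (G y) (y - x).
  have : p%:R * `|G y| * `|y - x| <= p%:R * L * (t * a).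
    by rewrite ler_pM// ?mulr_ge0 ?ler_wpM2l ?GL// ltW.
  have := FK x y rx0 ry0; rewrite ler_norml => /andP[_].
  have : K * `|x - y| <= K * (t * a) by rewrite ler_wpM2l// distrC ltW.
  have : e1 * `|w - y| <= e1 * (t * D) by rewrite ler_pM2l// distrC ltW.
  lra.
have nz : \forall z \near w & b \near (0 : R)^'+, `|z - w| < t * a.
  exact: (near_prodl (near_norm_lt w ta0)).
have nb : \forall z \near w & b \near (0 : R)^'+,
    approx_subgrad (Fs b) (grad (Fs b)) w r2 e1 /\ 0 < b.
  exact: (near_prodr (F := nbhs w) (filterI Fr (nbhs_right_gt (0 : R)))).
have ge := Fs_ge w ta0.
apply: filterS (filterI (filterI nz nb) (filterI FsL ge)).
move=> [z b] [[/= zw [Fb b0]] [/= FsLz Fsz]].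
have b_x := Fs_le x b0.
have xz : `|x - z| <= t * D.
  rewrite (le_trans _ taD)// -[x - z](subrKA w) (le_trans (ler_normD _ _))//.
  by rewrite lerD// distrC ltW.
have zr : `|z - w| < r.
  rewrite (lt_trans zw)// (le_lt_trans _ tD)// (le_trans _ taD)// lerDr.
  by rewrite mulr_ge0// ltW.
have zr2 : `|z - w| < r2.
  by move: zr; rewrite !lt_min => /andP[_ /andP[/andP[]]].
(* Based at [z] and tested at [x = w + t d], the inequality for [Fs b] bounds its slope by the
   quotient of [F], through [Fs b x <= F x] and the lower bound on [Fs b z]. *)
have := Fb x z rx2.
move=> /(_ zr2).
have -> : dot (grad (Fs b) z) (x - z) =
    t * dot (grad (Fs b) z) d + dot (grad (Fs b) z) (w - z).
  rewrite -dotZr -dotDr; congr dot.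
  by apply/rowP => i; rewrite !mxE; ring.
have := dot_ge (grad (Fs b) z) (w - z).
have : p%:R * `|grad (Fs b) z| * `|w - z| <= p%:R * `|L2| * (t * a).
  rewrite ler_pM// ?mulr_ge0 ?ler_wpM2l//; first exact: le_trans (ler_norm _).
  by rewrite distrC ltW.
have : e1 * `|x - z| <= e1 * (t * D) by rewrite ler_pM2l.
have : t * (2 * (e1 * D) + a * B) <= t * e.
  rewrite ler_pM2l// /e1 divfK ?gt_eqF//; lra.
move=> h1 h2 h3 h4 h5; rewrite -(ler_pM2l t0) gF; move: h1; rewrite /B; lra.
Qed.

(** The gradients at the points obtained for [e = 1 / (k + 1)] stay in a compact ball, and a cluster
    point [v] of them is one of the generators of the hull. Unlike the point [y] before, the same
    [v] serves every [e]. *)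
Lemma grad_smoothing_le_clarke w d :
  exists v, [/\ clarke F w v, `|v| <= sval (cid (G_bounded w)) & forall e, 0 <
    e ->
    \forall z \near w & b \near 0^'+, dot (grad (Fs b) z) d <= dot v d + e].
Proof.
pose L := sval (cid (G_bounded w)).
have /choice[y yP] k : exists y, [/\ `|y - w| < k.+1%:R^-1, differentiable F y,
    `|grad F y| <= L & \forall z \near w & b \near 0^'+,
      dot (grad (Fs b) z) d <= dot (grad F y) d + k.+1%:R^-1].
  by apply: grad_smoothing_le_grad; rewrite invr_gt0.
pose A := [set v : 'rV[R]_p | `|v - 0| <= L].
have cA : compact A by exact: compact_norm_ball.
pose g k := grad F (y k).
have [v [vL vg]] : A `&` cluster (g @ \oo) !=set0.
  by apply: cA; exists 0%N => // k _; rewrite /A/= subr0; have [] := yP k.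
have sub e N : 0 < e -> exists2 k, (N <= k)%N & `|g k - v| < e.
  move=> e0; have [|_ [[k Nk <-] kv]] := vg (g @` [set k | (N <= k)%N]) _ _
    (near_norm_lt v e0).
    by exists N => // k /= Nk; exists k.
  by exists k.
exists v; split.
- apply: sub_gen_smallest.
  have /choice[k kP] m : exists k, (m <= k)%N /\ `|g k - v| < m.+1%:R^-1.
    by have [|k mk kv] := sub m.+1%:R^-1 m; [rewrite invr_gt0|exists k].
  exists (fun m => y (k m)); split.
  + apply/(@cvgrPdist_lt _ _ _ \oo) => e e0; near=> m.
    rewrite distrC; have [+ _ _ _] := yP (k m); move/lt_trans; apply.
    have [mk _] := kP m.
    apply: (@le_lt_trans _ _ m.+1%:R^-1).
      by rewrite lef_pV2 ?posrE// ler_nat ltnS.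
    by near: m; exact: near_infty_natSinv_lt (PosNum e0).
  + by move=> m; have [] := yP (k m).
  + apply/(@cvgrPdist_lt _ _ _ \oo) => e e0; near=> m.
    rewrite distrC; have [_ /lt_trans] := kP m; apply.
    by near: m; exact: near_infty_natSinv_lt (PosNum e0).
- by move: vL; rewrite /A/= subr0.
- move=> e e0.
  have c0 : 0 < p%:R * `|d| + 1 by rewrite ltr_wpDl.
  have e2 : 0 < e / 2 / (p%:R * `|d| + 1) by rewrite !divr_gt0.
  have [N _ NP] := near_infty_natSinv_lt (PosNum (divr_gt0 e0 (ltr0Sn R 1))).
  have [k Nk] := sub _ N e2; rewrite ltr_pdivlMr// => kv.
  have [_ _ _] := yP k; apply: filterS => -[z b] /= /le_trans; apply.
  have /= := NP k Nk.
  have := dot_leW (g k - v) d; rewrite dotBl -/(g k).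
  have : p%:R * `|g k - v| * `|d| <= `|g k - v| * (p%:R * `|d| + 1).
    by rewrite mulrDr mulr1 mulrCA mulrA lerDl.
  move: kv (k.+1%:R^-1) (dot (g k) d) => + q gkd; lra.
Unshelve. all: by end_near. Qed.

(** The possible gradient values fill at most a compact ball, which is covered by two kinds of
    neighbourhoods. Values near the Clarke set satisfy the claim; a value far from it is separated
    by some direction [d], in which the previous lemma excludes nearby values for [z] near [w] and
    [b] small. *)
Lemma grad_smoothing_near_clarke w e : 0 < e ->
  \forall z \near w & b \near 0^'+, exists2 v, clarke F w v &
    dot (grad (Fs b) z - v) (grad (Fs b) z - v) < e.
Proof.
move=> e0; pose L := sval (cid (G_bounded w)).
(* Cutting at radius [L] provides the boundedness required for separation; by [key], the cut set
   still contains a suitable vector for each direction. *)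
pose C := [set v | clarke F w v /\ `|v| <= L].
have key d : exists2 v, C v & forall e, 0 < e ->
    \forall z \near w & b \near 0^'+, dot (grad (Fs b) z) d <= dot v d + e.
  have [v [? ? ?]] := grad_smoothing_le_clarke w d.
  by exists v.
have [L2 FsL] := Fs_bounded w.
pose P (i : 'rV[R]_p * R) v :=
  (forall c, C c -> e <= dot (v - c) (v - c)) -> grad (Fs i.2) i.1 <> v.
have /compact_near_coveringP cA := @compact_norm_ball R p 0 L2.
have H : forall x, [set y | `|y - 0| <= L2] x ->
  \forall x' \near x & i \near filter_prod (nbhs w) (0 : R)^'+, P i x'.
  move=> v _; have [farv|] := pselect (forall c, C c -> e <= dot (v - c) (v -
    c)); last first.
    move=> /existsNP[c /not_implyP[Cc /negP]]; rewrite -ltNge => vc.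
    have nv : \forall v' \near v, dot (v' - c) (v' - c) < e.
      exact: (@cvgr_lt _ _ (nbhs v) _ _ _ (@dot_sqr_continuous _ _ c v)).
    apply: filterS (near_prodl (F := nbhs v) nv) => -[v' i] /= v'e /(_ _ Cc).
    by rewrite leNgt v'e.
  have [c0 Cc0 _] := key 0.
  have [||d dP] := strict_separation (L := L) (ex_intro _ c0 Cc0) e0 _ _ farv.
  - by move=> c [].
  - move=> x y t [Cx xL] [Cy yL] /[dup] t01 /andP[t0 t1]; split.
      exact: convex_hull_conv.
    rewrite (le_trans (ler_normD _ _))// !normrZ !ger0_norm ?subr_ge0//.
    have : t * `|x| <= t * L by rewrite ler_wpM2l.
    have : (1 - t) * `|y| <= (1 - t) * L by rewrite ler_wpM2l ?subr_ge0.
    lra.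
  (* The gap [e / 2] of the separation is shared: [e / 4] for moving from [v] to [v'], [e / 4] for
     the bound on the gradients. *)
  have [c Cc /(_ (e / 4))] := key d; rewrite divr_gt0// => /(_ isT) dc.
  have nv : \forall v' \near v, dot d v - e / 4 < dot d v'.
    apply: (@cvgr_gt _ _ (nbhs v) _ _ _ (@dot_continuous _ _ d v)); rewrite
      ltrBlDr ltrDl; lra.
  exists ([set v' | dot d v - e / 4 < dot d v'],
          [set i | dot (grad (Fs i.2) i.1) d <= dot c d + e / 4]) => //.
  move=> [v' i] /= [v'd id] _ ii; move: id; rewrite ii dotC (dotC c).
  have := dP _ Cc; lra.
have {}H := cA _ _ P (filter_prod_filter _ _) H.
apply: filterS (filterI FsL (H _ _)) => -[z b] [/= FsLz /(_ (grad (Fs b) z))].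
rewrite /= subr0 => /(_ FsLz) PP.
apply: contrapT => /forall2NP ne.
apply: PP => // c [Cc cL]; rewrite leNgt; apply/negP => ec.
by have [] := ne c.
Qed.

(** Compactness of [K] makes the local estimate uniform. The graph point paired with
    [(z, grad (Fs b) z)] lies over the centre [w] of a covering neighbourhood instead of [z], so
    each of the two components is allowed [e^2 / 2] in squared distance. *)
Lemma excess_smoothing (K : set 'rV[R]_p) : compact K ->
  excess (graph_on K (fun w => [set grad (Fs b) w]))
         (graph_on K (clarke F)) @[b --> 0^'+] --> 0%E.
Proof.
move=> /compact_near_coveringP cK.
have main e : 0 < e -> \forall b \near 0^'+,
    (excess (graph_on K (fun w => [set grad (Fs b) w]))
         (graph_on K (clarke F)) <= e%:E)%E.
  move=> e0.
  have e2 : 0 < e ^+ 2 / 2 by rewrite divr_gt0// exprn_gt0.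
  pose P b z := K z -> exists w v, [/\ K w, clarke F w v &
    dot (z - w) (z - w) + dot (grad (Fs b) z - v) (grad (Fs b) z - v) <= e ^+
      2].
  have H : forall x, K x ->
      \forall x' \near x & i \near (0 : R)^'+, P i x'.
    move=> w Kw.
    have nz : \forall z \near w, dot (z - w) (z - w) < e ^+ 2 / 2.
      by apply: (@cvgr_lt _ _ (nbhs w) _ _ _ (@dot_sqr_continuous _ _ w w));
        rewrite subrr dot0r.
    apply: filterS (filterI (near_prodl nz) (grad_smoothing_near_clarke w e2)).
    move=> [z b] /= [zw [v Cv vb]] Kz; exists w, v; split => //.
    by rewrite [leRHS]splitr lerD// ltW.
  apply: filterS (cK _ _ P _ H) => b KP.
  rewrite /excess ge_max lee_fin ltW//=; apply: ge_ereal_sup.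
  move=> _ [_ [z [_ [Kz -> ->]]] <-].
  have [w [v [Kw Cv zwv]]] := KP z Kz Kz.
  apply: ereal_inf_le; exists (enorm (row_mx z (grad (Fs b) z) - row_mx w
    v))%:E.
    by exists (row_mx w v) => //; exists w, v.
  rewrite lee_fin -[leRHS](gtr0_norm e0) -sqrtr_sqr ler_wsqrtr//.
  apply: le_trans zwv; rewrite opp_row_mx add_row_mx big_split_ord/=.
  rewrite le_eqVlt; apply/orP; left; apply/eqP.
  congr (_ + _); apply: eq_bigr => i _; first by rewrite row_mxEl expr2.
  by rewrite row_mxEr expr2.
have ge0 b : (0 <= excess (graph_on K (fun w => [set grad (Fs b) w]))
         (graph_on K (clarke F)))%E.
  by rewrite /excess le_max lexx.
apply/fine_cvgP; split.
  apply: filterS (main 1 ltr01) => b b1.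
  by rewrite ge0_fin_numE// (le_lt_trans b1)// ltry.
apply/cvgrPdist_le => e e0; apply: filterS (main e e0) => b be /=.
rewrite sub0r normrN ger0_norm ?fine_ge0// -lee_fin fineK//.
by rewrite ge0_fin_numE// (le_lt_trans be)// ltry.
Qed.

End smoothing.

(** * Maximum functions *)

Lemma is_derive_line (R : realType) (p : nat) (f : 'rV[R]_p -> R)
    (y v : 'rV[R]_p) (s : R) : derivable f (y + s *: v) v ->
  is_derive s (1 : R) (fun s => f (y + s *: v)) ('D_v f (y + s *: v)).
Proof.
move=> df.
have E : (fun t : R => t^-1 *: (((fun s => f (y + s *: v)) \o shift s) (t *: 1)
  -
    f (y + s *: v))) = (fun t => t^-1 *: ((f \o shift (y + s *: v)) (t *: v) -
    f (y + s *: v))).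
  apply/funext => t /=; congr (_ *: (f _ - _)).
  by rewrite scaler1 scalerDl addrCA.
by split; rewrite /derivable /derive E.
Qed.

Lemma mean_value (R : realType) (p : nat) (f : 'rV[R]_p -> R) (x y : 'rV[R]_p) :
  (forall u, differentiable f u) ->
  exists2 s : R, 0 <= s <= 1 &
    f x - f y = dot (grad f (y + s *: (x - y))) (x - y).
Proof.
move=> df; pose g (s : R) := f (y + s *: (x - y)).
have dg (s : R) : is_derive s (1 : R) g (dot (grad f (y + s *: (x - y))) (x -
  y)).
  rewrite -grad_dot//; apply: is_derive_line.
  exact/diff_derivable.
have [|s] := @MVT_segment R g _ 0 1 ler01 (fun s _ => dg s).
  apply: derivable_within_continuous => s _; exact: ex_derive.
rewrite in_itv/= subr0 mulr1 /g scale1r scale0r addr0 subrKC => s01 fE.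
by exists s.
Qed.

Lemma convex_norm_lt (R : realType) (p : nat) (w x y : 'rV[R]_p) (r s : R) :
  `|x - w| < r -> `|y - w| < r -> 0 <= s <= 1 -> `|y + s *: (x - y) - w| < r.
Proof.
move=> xw yw /andP[s0 s1].
have -> : y + s *: (x - y) - w = s *: (x - w) + (1 - s) *: (y - w).
  by apply/rowP => i; rewrite !mxE; ring.
rewrite (le_lt_trans (ler_normD _ _))// !normrZ !ger0_norm ?subr_ge0//.
have [->|sN0] := eqVneq s 0; first by rewrite mul0r subr0 mul1r add0r.
have : s * `|x - w| < s * r by rewrite ltr_pM2l// lt_def sN0.
have : (1 - s) * `|y - w| <= (1 - s) * r by rewrite ler_wpM2l ?subr_ge0// ltW.
lra.
Qed.

(** * Estimates uniform over compact sets of [z] *)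

Section uniformity.
Context {R : realType} {Z : ptopologicalType} {p : nat}.
Variable h : 'rV[R]_p -> Z -> R.
Hypothesis h_diff : forall z w, differentiable (h ^~ z) w.
Hypothesis grad_continuous :
  continuous (fun x : 'rV[R]_p * Z => grad (h ^~ x.2) x.1).

Lemma grad_near_compact (Q : set Z) (w : 'rV[R]_p) (e : R) : compact Q -> 0 < e
  ->
  exists2 r, 0 < r & forall y, `|y - w| < r -> forall z, Q z ->
    `|grad (h ^~ z) y - grad (h ^~ z) w| <= e.
Proof.
move=> /compact_near_coveringP cQ e0; apply: near_norm_ltP.
apply: (cQ _ (nbhs w) (fun y z => `|grad (h ^~ z) y - grad (h ^~ z) w| <= e)).
move=> z _.
have e2 : 0 < e / 2 by rewrite divr_gt0.
have /= := near_norm_lt (grad (h ^~ z) w) e2.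
move=> /(@grad_continuous (w, z))[[A B] /= [Aw Bz] AB].
exists (B, A) => //= -[z' y] /= [Bz' Ay].
have h1 := AB (y, z') (conj Ay Bz'); have h2 := AB (w, z') (conj
  (nbhs_singleton Aw) Bz').
rewrite -[_ - _](subrKA (grad (h ^~ z) w)) (le_trans (ler_normD _ _))//.
rewrite [leRHS]splitr lerD//; first exact: ltW.
by rewrite distrC ltW.
Qed.

Lemma taylor_near_compact (Q : set Z) (w : 'rV[R]_p) (e : R) :
  compact Q -> 0 < e ->
  exists2 r, 0 < r & forall x y, `|x - w| < r -> `|y - w| < r ->
    forall z, Q z ->
    `|h x z - h y z - dot (grad (h ^~ z) y) (x - y)| <= e * `|x - y|.
Proof.
move=> cQ e0.
(* The factor 2 pays for passing through the gradient at [w]; [p + 1] absorbs the factor [p] of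
   [dot_le] and is nonzero even for [p = 0]. *)
have e1 : 0 < e / (2 * (p%:R + 1)) by rewrite divr_gt0// mulr_gt0// ltr_wpDl.
have [r r0 rP] := grad_near_compact w cQ e1.
exists r => // x y xw yw z Qz.
have [s /andP[s0 s1] ->] := mean_value x y (h_diff z).
rewrite -dotBl; set u := y + s *: (x - y).
have uw : `|u - w| < r by apply: convex_norm_lt; rewrite ?s0.
have gxy : `|grad (h^~ z) u - grad (h^~ z) y| <= e / (p%:R + 1).
  rewrite -[_ - _](subrKA (grad (h ^~ z) w)) (le_trans (ler_normD _ _))//.
  have -> : e / (p%:R + 1) = e / (2 * (p%:R + 1)) + e / (2 * (p%:R + 1)).
    by field; rewrite gt_eqF// ltr_wpDl.
  by rewrite lerD//; [exact: rP|rewrite distrC; exact: rP].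
rewrite (le_trans (dot_le _ _))// ler_wpM2r//.
rewrite -[leRHS](divfK (x := p%:R + 1)) ?gt_eqF ?ltr_wpDl//.
by rewrite mulrC ler_pM// lerDl.
Qed.

(** Crude bound, valid for all [z], for use outside the compact set on which the Taylor estimate
    holds. *)
Lemma lipschitz_of_grad_le (Psi : Z -> R) (w : 'rV[R]_p) (r c : R) :
  (forall y z, `|y - w| < r -> `|grad (h ^~ z) y| <= c * Psi z) ->
  forall x y z, `|x - w| < r -> `|y - w| < r ->
  `|h x z - h y z| <= p%:R * (c * Psi z) * `|x - y|.
Proof.
move=> hc x y z xw yw; have [s /andP[s0 s1] ->] := mean_value x y (h_diff z).
rewrite (le_trans (dot_le _ _))// ler_wpM2r// ler_wpM2l//; apply: hc.
by apply: convex_norm_lt; rewrite ?s0.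
Qed.

End uniformity.

(** * The maximum over [z]: attainment and approximate subgradients *)

Section hardmax.
Context {R : realType} {Z : ptopologicalType} {p : nat}.
Implicit Types (w x y : 'rV[R]_p) (z : Z) (r e : R).
Variables (h : 'rV[R]_p -> Z -> R) (psi Psi : Z -> R).
Hypothesis h_continuous : condH2 h.
Hypothesis psi_coercive : coercive psi.
Hypothesis h_le : forall w z, h w z <= - psi z.

Lemma continuous_h w : continuous (h w).
Proof.
move=> z U /(@h_continuous (w, z))[[A B] /= [Aw Bz] AB].
apply: filterS Bz => z' Bz'; apply: (AB (w, z')); split => //=.
exact: nbhs_singleton.
Qed.

Lemma near_lower w z (a : R) : a < h w z ->
  exists A B, [/\ nbhs w A, nbhs z B & forall y z', A y -> B z' -> a < h y z'].
Proof.
move=> /(lt_nbhsr) /(@h_continuous (w, z))[[A B] /= [Aw Bz] AB].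
by exists A, B; split => // y z' Ay Bz'; exact: (AB (y, z')).
Qed.

(** Outside the compact set where [psi <= - h w point], [h_le] puts [h w] below its value at
    [point]; the maximum over that set is therefore global. *)
Lemma hardmax_attained w : exists z, forall z', h w z' <= h w z.
Proof.
pose Q := [set z | psi z <= - h w point].
have Q0 : Q point by rewrite /Q/= lerNr.
have [z _ zmax] := @compact_EVT_max Z R (h w) Q (ex_intro _ point Q0)
  (@psi_coercive _) (continuous_subspaceT (@continuous_h w)).
exists z => z'; have [Qz'|] := pselect (Q z').
  by apply: zmax; rewrite inE.
rewrite /Q/= => /negP; rewrite -ltNge => z'w.
have := zmax point; rewrite inE => /(_ Q0).
have := h_le w z'; lra.
Qed.

Definition argmax w : Z := sval (cid (hardmax_attained w)).

Lemma argmaxP w z : h w z <= h w (argmax w).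
Proof. exact: (svalP (cid (hardmax_attained w))). Qed.

(** Attainment rules out the default value 0 of [max_of]. *)
Lemma hardmaxE w : hardmax h w = h w (argmax w).
Proof.
rewrite /hardmax /max_of; case: xgetP => [m _ [[z _ <-] ub]|/(_ (h w (argmax
  w))) []].
  by apply/eqP; rewrite eq_le argmaxP ub//; exists (argmax w).
by split; [exists (argmax w)|move=> _ [z _ <-]; exact: argmaxP].
Qed.

Lemma hardmax_ge w z : h w z <= hardmax h w.
Proof. by rewrite hardmaxE argmaxP. Qed.

(** For [y] near [w], [- psi (argmax y) >= h y (argmax y) >= h y point > h w point - 1]. *)
Lemma argmax_near_compact w : exists m, \forall y \near w, psi (argmax y) <= m.
Proof.
exists (1 - h w point).
have e : h w point - 1 < h w point by rewrite ltrBlDr ltrDl.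
have [A [B [Aw Bz AB]]] := near_lower e.
apply: filterS Aw => y Ay; 
have := AB y point Ay (nbhs_singleton Bz); have := argmaxP y point.
have := h_le y (argmax y); lra.
Qed.

Hypothesis h_diff : forall z w, differentiable (h ^~ z) w.
Hypothesis grad_continuous :
  continuous (fun x : 'rV[R]_p * Z => grad (h ^~ x.2) x.1).
Hypothesis Psi_continuous : continuous Psi.
Hypothesis grad_le : forall w, exists2 c, 0 <= c &
  \forall y \near w, forall z, `|grad (h ^~ z) y| <= c * Psi z.

Definition hardmax_subgrad w := grad (h ^~ (argmax w)) w.

Lemma bounded_on_sublevel m : exists M, forall z, psi z <= m -> Psi z <= M.
Proof.
have [[z0 Qz0]|Q0] := pselect ([set z | psi z <= m] !=set0); last first.
  by exists 0 => z Qz; exfalso; apply: Q0; exists z.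
have [c _ cmax] := @compact_EVT_max Z R Psi _ (ex_intro _ z0 Qz0)
  (@psi_coercive m) (continuous_subspaceT Psi_continuous).
by exists (Psi c) => z Qz; apply: cmax; rewrite inE.
Qed.

Lemma hardmax_subgrad_bounded w : exists L,
  \forall y \near w, `|hardmax_subgrad y| <= L.
Proof.
have [m mP] := argmax_near_compact w; have [M MP] := bounded_on_sublevel m.
have [c c0 cP] := grad_le w; exists (c * M).
apply: filterS2 mP cP => y /MP yM /(_ (argmax y)) /le_trans; apply.
by rewrite ler_wpM2l.
Qed.

(** The function [h ^~ (argmax y)] lies below the maximum and touches it at [y]. Its Taylor estimate
    is uniform because the maximizers stay in one compact sublevel set. *)
Lemma hardmax_subgradP w e : 0 < e ->
  exists2 r, 0 < r & approx_subgrad (hardmax h) hardmax_subgrad w r e.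
Proof.
move=> e0; have [m /near_norm_ltP[r1 r10 mP]] := argmax_near_compact w.
have [r2 r20 tP] := taylor_near_compact h_diff grad_continuous w (@psi_coercive
  m) e0.
exists (Num.min r1 r2); first by rewrite lt_min r10.
move=> x y; rewrite !lt_min => /andP[_ xw] /andP[/mP Qy yw].
have := tP x y xw yw _ Qy; rewrite ler_norml => /andP[+ _].
have := hardmax_ge x (argmax y); rewrite (hardmaxE y) /hardmax_subgrad; lra.
Qed.

End hardmax.

(** * Soft maximum functions *)

Lemma continuous_measurable_borel (R : realType) (Z : ptopologicalType)
    (f : Z -> R) :
  continuous f -> measurable_fun [set: borelType Z] (f : borelType Z -> R).
Proof.
move=> /continuousP cf; apply: (measurability _ (RGenOpens.measurableE R)).
move=> _ [_ [a [b ->] <-]]; rewrite setTI.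
by apply: sub_sigma_algebra; exact/cf/interval_open.
Qed.

Lemma grad_coord (R : realType) (p : nat) (f : 'rV[R]_p -> R) w i :
  grad f w ord0 i = 'D_(delta_mx ord0 i) f w.
Proof. by rewrite mxE. Qed.

Lemma is_derive_at0 (R : realType) (p : nat) (f : 'rV[R]_p -> R)
    (y v : 'rV[R]_p) (l : R) :
  is_derive (0 : R) (1 : R) (fun t : R => f (y + t *: v)) l -> is_derive y v f
    l.
Proof.
have E : (fun t : R => t^-1 *: (((fun s : R => f (y + s *: v)) \o shift 0) (t
  *: 1) -
    f (y + 0 *: v))) = (fun t => t^-1 *: ((f \o shift y) (t *: v) - f y)).
  apply/funext => t /=; rewrite scale0r !addr0; congr (_ *: (f _ - _)).
  by rewrite scaler1 addrC.
by case; rewrite /derivable /derive E => ? ?; split.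
Qed.

Lemma Rintegral_sum d (T : measurableType d) (R : realType)
    (mu : {measure set T -> \bar R}) (n : nat) (f : 'I_n -> T -> R) :
  (forall i, mu.-integrable setT (EFin \o f i)) ->
  \int[mu]_x (\sum_(i < n) f i x) = \sum_(i < n) \int[mu]_x f i x.
Proof.
move=> intf.
have int_s (s : seq 'I_n) : mu.-integrable setT (EFin \o (fun x => \sum_(i <-
  s) f i x)).
  have := @integrable_sum _ _ _ mu setT measurableT _ s xpredT _ (fun i _ =>
    intf i).
  by apply: eq_integrable => // x _; rewrite /= sumEFin.
elim: (index_enum _) => [|i s ih].
  rewrite big_nil; under eq_Rintegral do rewrite big_nil.
  by rewrite Rintegral_cst// mul0r.
rewrite big_cons -ih -RintegralD//.
by apply: eq_Rintegral => x _; rewrite big_cons.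
Qed.

Section softmax.
Context {R : realType} {Z : ptopologicalType} {p : nat}.
Implicit Types (w x y : 'rV[R]_p) (z : Z) (r e b : R).
Variable pi0 : probability (borelType Z) R.
Variables (h : 'rV[R]_p -> Z -> R) (psi Psi : Z -> R).
Hypothesis pi0_support : condH1 pi0.
Hypothesis h_continuous : condH2 h.
Hypothesis psi_coercive : coercive psi.
Hypothesis psi_ge0 : forall z, 0 <= psi z.
Hypothesis h_le : forall w z, h w z <= - psi z.
Hypothesis h_diff : forall z w, differentiable (h ^~ z) w.
Hypothesis grad_continuous :
  continuous (fun x : 'rV[R]_p * Z => grad (h ^~ x.2) x.1).
Hypothesis Psi_continuous : continuous Psi.
Hypothesis Psi_ge0 : forall z, 0 <= Psi z.
Hypothesis grad_le : forall w, exists2 c, 0 <= c &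
  \forall y \near w, forall z, `|grad (h ^~ z) y| <= c * Psi z.
Hypothesis Psi_integrable : pi0.-integrable setT (EFin \o Psi).

Let integrable (f : Z -> R) := pi0.-integrable setT (EFin \o f).

Lemma integrable_dominated (f : Z -> R) (a c : R) : continuous f ->
  (forall z, `|f z| <= a + c * Psi z) -> integrable f.
Proof.
move=> cf fac; apply: (@le_integrable _ _ _ pi0 setT _ _
    ((EFin \o cst a) \+ (fun z => c%:E * (EFin \o Psi) z))%E) => //.
- by apply/measurable_EFinP; exact: continuous_measurable_borel.
- move=> z _ /=; rewrite lee_fin (le_trans (fac z))// ler_norm//.
- apply: integrableD => //; first exact: finite_measure_integrable_cst.
  exact: integrableZl.
Qed.

(** Unnormalized Gibbs density with respect to [pi0]; its total mass is [partition_fun]. *)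
Definition gibbs b y z : R := expR (h y z / b).

Definition partition_fun b y : R := \int[pi0]_z gibbs b y z.

Lemma softmaxE b y : softmax pi0 h b y = b * ln (partition_fun b y).
Proof. by rewrite /softmax unlock. Qed.

Lemma gibbs_gt0 b y z : 0 < gibbs b y z.
Proof. exact: expR_gt0. Qed.

Lemma gibbs_le b y z : 0 < b -> gibbs b y z <= expR (- psi z / b).
Proof. by move=> b0; rewrite ler_expR ler_pM2r ?invr_gt0. Qed.

Lemma gibbs_le1 b y z : 0 < b -> gibbs b y z <= 1.
Proof.
move=> b0; rewrite (le_trans (gibbs_le _ _ b0))// -expR0 ler_expR.
by rewrite mulNr oppr_le0 divr_ge0// ltW.
Qed.

Lemma continuous_gibbs b y : continuous (gibbs b y).
Proof.
move=> z; apply: continuous_comp; last exact: continuous_expR.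
apply: (@continuousM R Z (h y) (cst b^-1)); last exact: cst_continuous.
exact: continuous_h.
Qed.

Lemma integrable_gibbsM b y (f : Z -> R) (a c : R) : 0 < b -> continuous f ->
  (forall z, `|f z| <= a + c * Psi z) -> integrable (fun z => gibbs b y z * f
    z).
Proof.
move=> b0 cf fac; apply: (integrable_dominated (a := a) (c := c)).
  move=> z; apply: (@continuousM R Z (gibbs b y)); last exact: cf.
  exact: continuous_gibbs.
move=> z; rewrite normrM (le_trans _ (fac z))// ler_piMl//.
by rewrite gtr0_norm ?gibbs_gt0// gibbs_le1.
Qed.

Lemma integrable_gibbs b y : 0 < b -> integrable (gibbs b y).
Proof.
move=> b0; apply: (integrable_dominated (a := 1) (c := 0)).
  exact: continuous_gibbs.
by move=> z; rewrite mul0r addr0 gtr0_norm ?gibbs_gt0// gibbs_le1.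
Qed.

Lemma partition_fun_le b y : 0 < b ->
  partition_fun b y <= expR (hardmax h y / b).
Proof.
move=> b0; have -> : expR (hardmax h y / b) =
    \int[pi0]_(z in [set: borelType Z]) expR (hardmax h y / b).
  rewrite Rintegral_cst//.
  rewrite -[LHS]mulr1; congr (_ * _).
  exact: (esym (congr1 fine (@probability_setT _ _ _ pi0))).
rewrite /partition_fun; apply: (@le_Rintegral _ _ _ pi0 setT) => //; first
  exact: integrable_gibbs.
  exact: finite_measure_integrable_cst.
move=> z _; rewrite ler_expR ler_pM2r ?invr_gt0//.
exact: (hardmax_ge h_continuous psi_coercive h_le).
Qed.

(** The constant [q] is the mass of an open set around [z] on which [h y > h w z - e] for all [y]
    near [w]. Full support makes it positive, and it depends on neither [y] nor [b]. *)
Lemma partition_fun_ge w z e : 0 < e -> exists2 q, 0 < q &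
  \forall y \near w, forall b, 0 < b ->
    q * expR ((h w z - e) / b) <= partition_fun b y.
Proof.
move=> e0; have : h w z - e < h w z by rewrite ltrBlDr ltrDl.
move=> /(near_lower h_continuous)[A [B [Aw Bz AB]]].
have [U [oU Uz UB]] : exists U : set Z, [/\ open U, U z & U `<=` B].
  by move: Bz; rewrite nbhsE => -[U [oU Uz] UB]; exists U.
have mU : measurable (U : set (borelType Z)) by exact: sub_sigma_algebra.
have U0 : (0 < pi0 U)%E.
  by have : [set: Z] z by []; rewrite -pi0_support => /(_ U oU Uz).
exists (fine (pi0 U)); first by rewrite fine_gt0// U0/= (le_lt_trans
  (probability_le1 _ mU))// ltry.
apply: filterS Aw => y Ay b b0.
rewrite mulrC -Rintegral_cst//.
rewrite (@le_trans _ _ (\int[pi0]_(z in U) gibbs b y z))//.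
  apply: le_Rintegral => //.
  - exact: finite_measure_integrable_cst.
  - by apply: integrableS (integrable_gibbs y b0).
  - move=> z' Uz'; rewrite ler_expR ler_pM2r ?invr_gt0// ltW//.
    exact/AB/UB.
apply: fine_le.
- exact/integrable_fin_num/(integrableS _ _ _ (integrable_gibbs y b0)).
- exact/integrable_fin_num/integrable_gibbs.
- apply: ge0_subset_integral => //.
    by have /integrableP[] := integrable_gibbs y b0.
  by move=> z' _; rewrite lee_fin ltW// gibbs_gt0.
Qed.

Lemma partition_fun_gt0 b y : 0 < b -> 0 < partition_fun b y.
Proof.
move=> b0; have [q q0 /nbhs_singleton/(_ b b0)] := partition_fun_ge y point
  ltr01.
by apply: lt_le_trans; rewrite mulr_gt0// expR_gt0.
Qed.

Lemma softmax_le_hardmax b y : 0 < b -> softmax pi0 h b y <= hardmax h y.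
Proof.
move=> b0; rewrite softmaxE mulrC -ler_pdivlMr// -ler_expR lnK
  ?partition_fun_le//.
by rewrite posrE partition_fun_gt0.
Qed.

(** Lower half of Laplace's principle: taking logarithms in [partition_fun_ge] at a maximizer leaves
    the error [b ln q], which vanishes with [b]. *)
Lemma softmax_near_ge w e : 0 < e ->
  \forall y \near w & b \near 0^'+, hardmax h w - e <= softmax pi0 h b y.
Proof.
move=> e0; have e2 : 0 < e / 2 by rewrite divr_gt0.
have [q q0 qP] := partition_fun_ge w (argmax h_continuous psi_coercive h_le w)
  e2.
have nb : \forall b \near (0 : R)^'+, 0 < b /\ b * (`|ln q| + 1) < e / 2.
  apply: filterI; first exact: nbhs_right_gt.
  have := @nbhs_right_lt R 0 (e / 2 / (`|ln q| + 1)).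
  rewrite divr_gt0 ?ltr_wpDl// => /(_ isT); apply: filterS => b.
  by rewrite ltr_pdivlMr ?ltr_wpDl.
exists ([set y | forall b, 0 < b -> q * expR ((h w (argmax h_continuous
  psi_coercive h_le w) - e / 2) / b) <=
    partition_fun b y], [set b | 0 < b /\ b * (`|ln q| + 1) < e / 2]) => //.
move=> [y b] /= [/(_ b) yb [b0 be]].
rewrite softmaxE (hardmaxE h_continuous psi_coercive h_le).
move: (yb b0); rewrite -ler_ln ?posrE ?partition_fun_gt0 ?mulr_gt0 ?expR_gt0//.
rewrite lnM ?posrE ?expR_gt0// expRK -(ler_pM2l b0) mulrDr mulrCA divff
  ?gt_eqF// mulr1.
apply: le_trans.
have : - (b * `|ln q|) <= b * ln q.
  by rewrite -mulrN ler_pM2l// lerNl -normrN ler_norm.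
move: be; rewrite mulrDr mulr1; lra.
Qed.

Lemma is_derive_gibbs b y v z (t : R) :
  is_derive t (1 : R) (fun t => gibbs b (y + t *: v) z)
    (gibbs b (y + t *: v) z * (dot (grad (h ^~ z) (y + t *: v)) v / b)).
Proof.
have d1 : is_derive t (1 : R) (fun t => h (y + t *: v) z) (dot (grad (h ^~ z)
  (y + t *: v)) v).
  rewrite -grad_dot//; apply: (@is_derive_line _ _ (h ^~ z)).
  exact/diff_derivable.
have -> : (fun t => gibbs b (y + t *: v) z) =
    expR \o (b^-1 \*: (fun t => h (y + t *: v) z)).
  by apply/funext => u /=; rewrite /gibbs mulrC.
have d2 := @is_deriveZ R R R _ b^-1 t 1 _ d1.
have /is_derive_eq := @is_derive1_comp R expR _ t _ _ (is_derive_expR _) d2;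
  apply.
by congr (expR _ * _); exact: mulrC.
Qed.

Lemma continuous_grad_section y : continuous (fun z => grad (h ^~ z) y).
Proof.
move=> z U /(@grad_continuous (y, z))[[A B] /= [Ay Bz] AB].
apply: filterS Bz => z' Bz'; apply: (AB (y, z')); split => //=.
exact: nbhs_singleton.
Qed.

Lemma continuous_dot_grad y v : continuous (fun z => dot (grad (h ^~ z) y) v).
Proof.
move=> z; have -> : (fun z => dot (grad (h ^~ z) y) v) =
    dot v \o (fun z => grad (h ^~ z) y) by apply/funext => z' /=; rewrite dotC.
apply: continuous_comp; first exact: continuous_grad_section.
exact: dot_continuous.
Qed.

Lemma integrable_gibbs_dot_grad b y v : 0 < b ->
  integrable (fun z => gibbs b y z * dot (grad (h ^~ z) y) v).
Proof.
move=> b0; have [c c0 /nbhs_singleton cP] := grad_le y.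
apply: (integrable_gibbsM y (a := 0) (c := p%:R * c * `|v|) b0) => //.
  exact: continuous_dot_grad.
move=> z; rewrite add0r (le_trans (dot_le _ _))// -!mulrA ler_wpM2l//.
by rewrite [_ * Psi z]mulrC mulrA ler_wpM2r.
Qed.

Lemma is_derive_partition_fun b y v : 0 < b ->
  is_derive (0 : R) (1 : R) (fun t => partition_fun b (y + t *: v))
    (\int[pi0]_z (gibbs b y z * (dot (grad (h ^~ z) y) v / b))).
Proof.
move=> b0; have [c c0 /near_norm_ltP[r r0 cP]] := grad_le y.
(* For [|t| < s] the point [y + t v] stays in the ball where the gradients are dominated. As the
   Gibbs density is at most 1, the function [g] below dominates the derivatives. *)
pose s := r / (`|v| + 1).
have s0 : 0 < s by rewrite divr_gt0// ltr_wpDl.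
have I0 : `]-s, s[%classic 0 by rewrite /= in_itv/= oppr_lt0 s0.
pose f (t : R) z := gibbs b (y + t *: v) z.
have df t z : is_derive t (1 : R) (f ^~ z)
    (f t z * (dot (grad (h ^~ z) (y + t *: v)) v / b)) := is_derive_gibbs b y v
      z t.
have d1E t z : partial1of2 f t z = f t z * (dot (grad (h ^~ z) (y + t *: v)) v
  / b).
  by rewrite partial1of2E; have [] := df t z.
have int_f t : `]-s, s[%classic t -> pi0.-integrable setT (EFin \o f t).
  by move=> _; exact: integrable_gibbs.
have derf t z : `]-s, s[%classic t -> [set: borelType Z] z -> derivable (f ^~
  z) t 1.
  by move=> _ _; have [] := df t z.
pose g z := p%:R * c * `|v| / b * Psi z.
have g0 z : 0 <= g z by rewrite /g mulr_ge0// divr_ge0 ?mulr_ge0// ltW.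
have ig : pi0.-integrable setT (EFin \o g).
  have := @integrableZl _ _ _ pi0 setT measurableT (p%:R * c * `|v| / b) _
    Psi_integrable.
  by apply: eq_integrable.
have fg t z : `]-s, s[%classic t -> [set: borelType Z] z -> `|partial1of2 f t
  z| <= g z.
  rewrite /= in_itv/= -ltr_norml => ts _; rewrite d1E normrM gtr0_norm
    ?gibbs_gt0//.
  rewrite (@le_trans _ _ `|dot (grad (h^~ z) (y + t *: v)) v / b|)//.
    rewrite ler_piMl//; exact: gibbs_le1.
  rewrite normrM normfV (gtr0_norm b0) /g mulrAC ler_pM2r ?invr_gt0//.
  rewrite (le_trans (dot_le _ _))// -!mulrA ler_wpM2l//.
  rewrite [_ * Psi z]mulrC mulrA ler_wpM2r//; apply: cP.
  rewrite addrC addKr normrZ; move: ts; rewrite ltr_pdivlMr ?ltr_wpDl//.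
  apply: le_lt_trans; rewrite ler_wpM2l// lerDl//.
have D := @derivable_under_integral R _ (borelType Z) pi0 f setT measurableT 0
  (-s) s I0 int_f derf g g0 ig fg.
have V := @differentiation_under_integral R _ (borelType Z) pi0 f setT
  measurableT 0 (-s) s I0 int_f derf g g0 ig fg.
split => //; rewrite -derive1E V; apply: eq_Rintegral => z _.
by rewrite d1E /f scale0r addr0.
Qed.

Lemma is_derive_softmax b y v : 0 < b ->
  is_derive y v (softmax pi0 h b)
    ((\int[pi0]_z (gibbs b y z * dot (grad (h ^~ z) y) v)) / partition_fun b y).
Proof.
move=> b0; apply: is_derive_at0.
have N0 : 0 < partition_fun b y by exact: partition_fun_gt0.
have -> : (fun t => softmax pi0 h b (y + t *: v)) =
    b \*: (@ln R \o (fun t : R => partition_fun b (y + t *: v)) : R -> R^o).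
  by apply/funext => t; rewrite softmaxE.
have d1 := is_derive_partition_fun y v b0.
have d2 : is_derive (partition_fun b (y + 0 *: v)) (1 : R) (@ln R)
    (partition_fun b y)^-1.
  by rewrite scale0r addr0; exact: is_derive1_ln.
have d3 := @is_derive1_comp R (@ln R) _ _ _ _ d2 d1.
have /is_derive_eq := @is_deriveZ R R R _ b 0 1 _ d3; apply.
have -> : \int[pi0]_z (gibbs b y z * (dot (grad (h ^~ z) y) v / b)) =
    (\int[pi0]_z (gibbs b y z * dot (grad (h ^~ z) y) v)) / b.
  rewrite -RintegralZr//; last exact: integrable_gibbs_dot_grad.
  by apply: eq_Rintegral => z _; rewrite mulrA.
by rewrite /GRing.scale/=; field; rewrite !gt_eqF.
Qed.

(** The gradient is the Gibbs mean of the gradients of [h]. Since [grad] consists of coordinate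
    derivatives, a general direction is reached by expanding [v] in coordinates. *)
Lemma grad_softmax_dot b y v : 0 < b ->
  dot (grad (softmax pi0 h b) y) v * partition_fun b y =
  \int[pi0]_z (gibbs b y z * dot (grad (h ^~ z) y) v).
Proof.
move=> b0.
have N0 : 0 < partition_fun b y by exact: partition_fun_gt0.
have gE i : grad (softmax pi0 h b) y ord0 i = 
  (\int[pi0]_z (gibbs b y z * grad (h ^~ z) y ord0 i)) / partition_fun b y.
  rewrite grad_coord; have [_ ->] := is_derive_softmax y (delta_mx ord0 i) b0.
  by congr (_ / _); apply: eq_Rintegral => z _; rewrite dot_delta.
have int_i i : integrable (fun z => gibbs b y z * grad (h ^~ z) y ord0 i).
  have := integrable_gibbs_dot_grad y (delta_mx ord0 i) b0.
  by under eq_fun do rewrite /= dot_delta.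
rewrite [dot _ _]/dot mulr_suml.
transitivity (\sum_(i < p) \int[pi0]_z (gibbs b y z * grad (h ^~ z) y ord0 i *
  v ord0 i)).
  apply: eq_bigr => i _; rewrite RintegralZr//; last exact: int_i.
  by rewrite gE mulrAC divfK// gt_eqF.
rewrite -Rintegral_sum//; last first.
  move=> i; have := @integrableZr _ _ _ pi0 setT measurableT (v ord0 i) _
    (int_i i).
  by apply: eq_integrable.
by apply: eq_Rintegral => z _; rewrite /dot mulr_sumr; apply: eq_bigr => i _;
  rewrite mulrA.
Qed.

Lemma integrable_scale (a : R) (f : Z -> R) :
  integrable f -> integrable (fun z => a * f z).
Proof.
move=> /(@integrableZl _ _ _ pi0 setT measurableT a).
by apply: eq_integrable.
Qed.

Lemma integrable_add (f g : Z -> R) :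
  integrable f -> integrable g -> integrable (fun z => f z + g z).
Proof.
move=> fi gi; have := @integrableD _ _ _ pi0 setT measurableT _ _ fi gi.
by apply: eq_integrable.
Qed.

(** [M] and [r] are fixed before [k]: the sublevel set [psi <= M] can be chosen first, and any
    constant times the tail weight [exp (- M / b)] is then negligible for small [b]. *)
Lemma partition_fun_tail w : exists M, exists2 r, 0 < r &
  forall k, \forall b \near 0^'+, 0 < b /\
    forall y, `|y - w| < r -> k * expR (- M / b) <= partition_fun b y.
Proof.
have [q q0 /near_norm_ltP[r r0 rP]] := partition_fun_ge w point ltr01.
(* [- m / b] is the exponent in the lower bound of the partition function; the extra unit in
   [M = m + 1] leaves a factor [exp (- 1 / b) <= b], which beats [k]. *)
pose m := 1 - h w point.
exists (m + 1), r => // k.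
have K0 : 0 < `|k| + 1 by rewrite ltr_wpDl.
near=> b.
have b0 : 0 < b by near: b; exact: nbhs_right_gt.
have bk : b < q / (`|k| + 1) by near: b; apply: nbhs_right_lt; rewrite divr_gt0.
split => // y yr; apply: le_trans (rP y yr b b0).
have -> : - (m + 1) / b = - b^-1 + (h w point - 1) / b.
  by rewrite /m; field; rewrite gt_eqF.
rewrite expRD mulrA ler_pM2r ?expR_gt0//.
have eb : expR (- b^-1) <= b.
  rewrite expRN -[leRHS]invrK lef_pV2 ?posrE ?expR_gt0 ?invr_gt0//.
  by rewrite (le_trans _ (expR_ge1Dx _))// lerDr.
rewrite (@le_trans _ _ (`|k| * expR (- b^-1)))//.
  by rewrite ler_wpM2r ?ler_norm// expR_ge0.
rewrite (@le_trans _ _ (`|k| * b))// ?ler_wpM2l//.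
move: bk; rewrite ltr_pdivlMr// mulrDr mulr1; lra.
Unshelve. all: by end_near. Qed.

(** On [psi <= M] the factor [Psi] is bounded; off it the density is at most [exp (- M / b)]. *)
Lemma gibbs_le_tail b y z (M N : R) : 0 < b ->
  (forall z, psi z <= M -> Psi z <= N) ->
  gibbs b y z * Psi z <= `|N| * gibbs b y z + expR (- M / b) * Psi z.
Proof.
move=> b0 MN; have g0 := gibbs_gt0 b y z; have [zM|zM] := leP (psi z) M.
  rewrite -[leLHS]addr0 lerD ?mulr_ge0 ?expR_ge0// mulrC ler_pM2r//.
  exact: le_trans (MN z zM) (ler_norm _).
rewrite -[leLHS]add0r lerD//; first by rewrite mulr_ge0// ltW.
rewrite ler_wpM2r//.
rewrite (le_trans (gibbs_le y z b0))// ler_expR ler_pM2r ?invr_gt0//.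
by rewrite lerN2 ltW.
Qed.

(** After integration of [gibbs_le_tail], the sublevel set contributes [c |N|] times the partition
    function, and the tail at most once that function, by [partition_fun_tail] with [k = c EP]. *)
Lemma softmax_grad_bounded w : exists L,
  \forall y \near w & b \near 0^'+, `|grad (softmax pi0 h b) y| <= L.
Proof.
have [M [r1 r10 tailP]] := partition_fun_tail w.
have [N NP] := bounded_on_sublevel psi_coercive Psi_continuous M.
have [c c0 /near_norm_ltP[r2 r20 cP]] := grad_le w.
pose EP := \int[pi0]_z Psi z.
exists (c * `|N| + 1).
have nb := tailP (c * EP).
have r0 : 0 < Num.min r1 r2 by rewrite lt_min r10.
exists ([set y | `|y - w| < Num.min r1 r2], [set b | 0 < b /\
    forall y, `|y - w| < r1 -> c * EP * expR (- M / b) <= partition_fun b y]).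
  by split => //; exact: near_norm_lt.
move=> [y b] /= [+ [b0 tb]]; rewrite lt_min => /andP[/tb {}tb /cP {}cP].
apply: rV_norm_le => [|i]; first by rewrite addr_ge0// mulr_ge0.
have N0 : 0 < partition_fun b y by exact: partition_fun_gt0.
rewrite -(ler_pM2r N0) -[partition_fun b y in leLHS]gtr0_norm// -normrM.
rewrite -dot_delta grad_softmax_dot//.
apply: (le_trans (le_normr_Rintegral _ _)) => //.
  exact: integrable_gibbs_dot_grad.
have -> : (c * `|N| + 1) * partition_fun b y =
  c * `|N| * partition_fun b y + partition_fun b y by ring.
apply: (@le_trans _ _ (\int[pi0]_z (c * `|N| * gibbs b y z + c * expR (- M / b)
  * Psi z))).
  apply: le_Rintegral => //.
  - exact: integrable_norm (integrable_gibbs_dot_grad _ _ b0).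
  - by apply: integrable_add; apply: integrable_scale => //; exact:
    integrable_gibbs.
  - move=> z _; rewrite dot_delta normrM gtr0_norm ?gibbs_gt0//.
    rewrite (@le_trans _ _ (c * (gibbs b y z * Psi z)))//.
      rewrite mulrCA ler_pM2l ?gibbs_gt0//.
      exact: le_trans (norm_coord _ _) (cP z).
    by rewrite -!mulrA -mulrDr ler_wpM2l// gibbs_le_tail.
rewrite RintegralD//; first last.
- exact: integrable_scale.
- by apply: integrable_scale; exact: integrable_gibbs.
rewrite !RintegralZl//; last exact: integrable_gibbs.
by rewrite lerD2l -/EP mulrAC.
Qed.

(** The ratio of the partition functions at [x] and [y] is the Gibbs mean at [y] of
    [exp ((h x - h y) / b)]. On [psi <= M] the Taylor estimate costs [e / 2]; the remaining [e / 2]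
    pays for the tail. *)
Lemma softmax_subgrad w e : 0 < e -> exists2 r, 0 < r &
  \forall b \near 0^'+,
    approx_subgrad (softmax pi0 h b) (grad (softmax pi0 h b)) w r e.
Proof.
move=> e0; have [M [r1 r10 tailP]] := partition_fun_tail w.
have e2 : 0 < e / 2 by rewrite divr_gt0.
have [r2 r20 taylor] :=
  taylor_near_compact h_diff grad_continuous w (@psi_coercive M) e2.
have [c c0 /near_norm_ltP[r3 r30 cP]] := grad_le w.
pose EP := \int[pi0]_z Psi z.
exists (Num.min r1 (Num.min r2 r3)); first by rewrite !lt_min r10 r20.
(* Off the sublevel set the Taylor error is at most [2 p c Psi z |x - y|]; this constant makes its
   integral against the tail weight at most [e / 2 |x - y|] times the partition function. *)
apply: filterS (tailP (2 * (p%:R * c) * EP / (e / 2))) => b [b0 tb] x y.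
rewrite !lt_min => /andP[_ /andP[xr2 xr3]] /andP[/tb {}tb /andP[yr2 yr3]].
have N0 : 0 < partition_fun b y by exact: partition_fun_gt0.
pose n := `|x - y|; pose D := dot (grad (softmax pi0 h b) y) (x - y).
pose T := expR (- M / b).
pose E := expR ((D - e * n) / b).
have n0 : 0 <= n by exact: normr_ge0.
have EP0 : 0 <= EP by exact: Rintegral_ge0.
have T0 : 0 < T by exact: expR_gt0.
have E0 : 0 < E by exact: expR_gt0.
suff Nx : E * partition_fun b y <= partition_fun b x.
  rewrite !softmaxE -/n -/D.
  move: Nx; rewrite -ler_ln ?posrE ?mulr_gt0 ?partition_fun_gt0//.
  rewrite lnM ?posrE// expRK -(ler_pM2l b0) mulrDr mulrCA divff ?gt_eqF// mulr1.
  lra.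
(* Jensen's inequality in pointwise form, from exp u >= 1 + u. *)
have pointwise z : E * (1 + (e / 2 * n - D) / b) * gibbs b y z +
    E / b * (gibbs b y z * dot (grad (h ^~ z) y) (x - y)) +
    - (E / b * (2 * (p%:R * c) * n * T)) * Psi z <= gibbs b x z.
  have Eg : E * (1 + (h x z - h y z - (D - e * n)) / b) * gibbs b y z <= gibbs
    b x z.
    have -> : gibbs b x z = E * expR ((h x z - h y z - (D - e * n)) / b) *
      gibbs b y z.
      by rewrite /gibbs /E -!expRD; congr expR; field; rewrite gt_eqF.
    by rewrite ler_pM2r ?gibbs_gt0// ler_pM2l// expR_ge1Dx.
  apply: le_trans Eg; rewrite -subr_ge0.
  set g := gibbs b y z; set d := dot (grad (h ^~ z) y) (x - y).
  have -> : E * (1 + (h x z - h y z - (D - e * n)) / b) * g -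
    (E * (1 + (e / 2 * n - D) / b) * g + E / b * (g * d) +
     - (E / b * (2 * (p%:R * c) * n * T)) * Psi z) =
    E / b * (g * (h x z - h y z - d + e / 2 * n) + 2 * (p%:R * c) * n * T * Psi
      z).
    by field; rewrite gt_eqF.
  have g0 : 0 < g by exact: gibbs_gt0.
  rewrite mulr_ge0 ?divr_ge0//; [exact: ltW|exact: ltW|].
  have P0 := Psi_ge0 z.
  (* On the sublevel set both summands are nonnegative. Off it, [h x z - h y z - d >= - 2 k] and the
     weight [g] is at most [T], so the [Psi] term compensates. *)
  have [zM|zM] := leP (psi z) M.
    rewrite addr_ge0// ?mulr_ge0//; [exact: ltW| |exact: ltW].
    have := taylor x y xr2 yr2 z zM; rewrite ler_norml -/d -/n => /andP[+ _];
      lra.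
  have gT : g <= T.
    rewrite (le_trans (gibbs_le y z b0))// ler_expR ler_pM2r ?invr_gt0//.
    by rewrite lerN2 ltW.
  have lip : `|h x z - h y z| <= p%:R * (c * Psi z) * n.
    by apply: (lipschitz_of_grad_le h_diff (w := w) (r := r3)) => // u z' ur;
      exact: cP.
  have dle : d <= p%:R * (c * Psi z) * n.
    by rewrite (le_trans (dot_leW _ _))// ler_wpM2r// ler_wpM2l// cP.
  set k := p%:R * (c * Psi z) * n in lip dle *.
  have k0 : 0 <= k by rewrite !mulr_ge0.
  have -> : 2 * (p%:R * c) * n * T * Psi z = 2 * (T * k) by rewrite /k; ring.
  have gk : g * k <= T * k by rewrite ler_wpM2r.
  have : g * (- (2 * k)) <= g * (h x z - h y z - d + e / 2 * n).
    rewrite ler_pM2l//; have : 0 <= e / 2 * n by rewrite mulr_ge0// ltW.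
    move: lip; rewrite ler_norml => /andP[]; lra.
  lra.
apply: (@le_trans _ _ (\int[pi0]_z (E * (1 + (e / 2 * n - D) / b) * gibbs b y z
  +
    E / b * (gibbs b y z * dot (grad (h ^~ z) y) (x - y)) +
    - (E / b * (2 * (p%:R * c) * n * T)) * Psi z))); last first.
  apply: le_Rintegral => //; last exact: integrable_gibbs.
  apply: integrable_add; last exact: integrable_scale.
  by apply: integrable_add; apply: integrable_scale;
    [exact: integrable_gibbs|exact: integrable_gibbs_dot_grad].
have i1 : integrable (fun z => E * (1 + (e / 2 * n - D) / b) * gibbs b y z).
  by apply: integrable_scale; exact: integrable_gibbs.
have i2 : integrable (fun z => E / b * (gibbs b y z * dot (grad (h ^~ z) y) (x
  - y))).
  by apply: integrable_scale; exact: integrable_gibbs_dot_grad.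
rewrite RintegralD//; last 2 first.
- exact: integrable_add.
- exact: integrable_scale.
rewrite RintegralD// !RintegralZl//; last 2 first.
- exact: integrable_gibbs_dot_grad.
- exact: integrable_gibbs.
rewrite -grad_softmax_dot// -/D -/EP -/(partition_fun b y).
have : n * (2 * (p%:R * c) * EP * T) <= n * (e / 2 * partition_fun b y).
  by rewrite ler_wpM2l// -ler_pdivrMl// mulrC mulrAC.
move=> nT; rewrite -subr_ge0.
(* The mean of the linear term is [D], so the terms in [D] cancel and only the slack [e / 2] remains
   against the tail. *)
have -> : E * (1 + (e / 2 * n - D) / b) * partition_fun b y +
    E / b * (D * partition_fun b y) +
    - (E / b * (2 * (p%:R * c) * n * T)) * EP - E * partition_fun b y =
    E / b * (n * (e / 2 * partition_fun b y) - n * (2 * (p%:R * c) * EP * T)).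
  by field; rewrite gt_eqF.
by rewrite mulr_ge0 ?subr_ge0// divr_ge0// ltW.
Qed.

End softmax.

(** * Averages *)

Section average.
Context {R : realType} {n p : nat}.
Implicit Types (w x y : 'rV[R]_p) (r e b : R).

Definition vaverage (g : 'I_n -> 'rV[R]_p -> 'rV[R]_p) w : 'rV[R]_p :=
  n%:R^-1 *: \sum_(i < n) g i w.

Lemma norm_vaverage_le (g : 'I_n -> 'rV[R]_p -> 'rV[R]_p) (L : 'I_n -> R) y :
  (forall i, `|g i y| <= L i) ->
  `|vaverage g y| <= n%:R^-1 * \sum_(i < n) L i.
Proof.
move=> gL; rewrite /vaverage normrZ ger0_norm ?invr_ge0// ler_wpM2l ?invr_ge0//.
by rewrite (le_trans (ler_norm_sum _ _ _))// ler_sum.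
Qed.

Lemma average_le (f g : 'I_n -> 'rV[R]_p -> R) x y :
  (forall i, f i x <= g i y) -> average f x <= average g y.
Proof. by move=> fg; rewrite /average ler_wpM2l ?invr_ge0// ler_sum. Qed.

Lemma dot_vaverage (g : 'I_n -> 'rV[R]_p -> 'rV[R]_p) y v :
  dot (vaverage g y) v = n%:R^-1 * \sum_(i < n) dot (g i y) v.
Proof.
rewrite dotZl dotC linear_sum; congr (_ * _).
by apply: eq_bigr => i _; exact: dotC.
Qed.

Hypothesis n_gt0 : (0 < n)%N.

Lemma average_cst (a : R) : n%:R^-1 * \sum_(i < n) a = a.
Proof.
rewrite sumr_const card_ord -[X in _ * X]mulr_natl mulrA mulVf ?mul1r//.
by rewrite pnatr_eq0 -lt0n.
Qed.

Lemma approx_subgrad_average (f : 'I_n -> 'rV[R]_p -> R)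
    (g : 'I_n -> 'rV[R]_p -> 'rV[R]_p) w r e :
  (forall i, approx_subgrad (f i) (g i) w r e) ->
  approx_subgrad (average f) (vaverage g) w r e.
Proof.
move=> fg x y xw yw; rewrite dot_vaverage /average -[e * _]average_cst.
rewrite -mulrDr -mulrBr ler_wpM2l ?invr_ge0// -big_split/= -sumrB ler_sum// =>
  i _.
exact: fg.
Qed.

End average.

(** Stated as an eventual property of the radius, so that finitely many functions share a radius by
    intersecting filters. *)
Lemma approx_subgrad_near (R : realType) (p : nat) (f : 'rV[R]_p -> R) g w (r e
  : R) :
  0 < r -> approx_subgrad f g w r e ->
  \forall s \near 0^'+, approx_subgrad f g w s e.
Proof.
move=> r0 fg; apply: filterS (nbhs_right_lt r0) => s sr x y xs ys.
by apply: fg; [exact: lt_trans sr|exact: lt_trans sr].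
Qed.

Lemma grad_average (R : realType) (n p : nat) (f : 'I_n -> 'rV[R]_p -> R) y :
  (forall i v, derivable (f i) y v) ->
  grad (average f) y = vaverage (fun i => grad (f i)) y.
Proof.
move=> df; apply/rowP => j; rewrite grad_coord /vaverage mxE summxE.
have -> : average f = n%:R^-1 \*: \sum_(i < n) f i.
  by apply/funext => w; rewrite /average fct_sumE.
rewrite deriveZ; last exact: derivable_sum.
rewrite derive_sum//; congr (_ * _); apply: eq_bigr => i _.
by rewrite grad_coord.
Qed.

Lemma grad_average_bounded (R : realType) (n p : nat)
    (f : R -> 'I_n -> 'rV[R]_p -> R) (w : 'rV[R]_p) :
  (forall b i y v, 0 < b -> derivable (f b i) y v) ->
  (forall i, exists L, \forall y \near w & b \near 0^'+, `|grad (f b i) y| <=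
    L) ->
  exists L, \forall y \near w & b \near 0^'+, `|grad (average (f b)) y| <= L.
Proof.
move=> df /choice[L LP]; exists (n%:R^-1 * \sum_(i < n) L i).
have near_b : \forall y \near w & b \near (0 : R)^'+, 0 < b.
  exact: (near_prodr (F := nbhs w) (nbhs_right_gt (0 : R))).
apply: filterS (filterI near_b (filter_forall _ LP)) => -[y b] /= [b0 yb].
rewrite grad_average => [|i v]; last exact: df.
exact: (norm_vaverage_le (g := fun i => grad (f b i))).
Qed.

Lemma average_near_ge (R : realType) (n p : nat) (f : R -> 'I_n -> 'rV[R]_p ->
  R)
    (g : 'I_n -> 'rV[R]_p -> R) (w : 'rV[R]_p) (e : R) : (0 < n)%N ->
  (forall i, \forall y \near w & b \near 0^'+, g i w - e <= f b i y) ->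
  \forall y \near w & b \near 0^'+, average g w - e <= average (f b) y.
Proof.
move=> n_gt0 fg; apply: filterS (filter_forall _ fg) => -[y b] /= yb.
rewrite /average -[e](average_cst n_gt0) -mulrBr -sumrB.
by rewrite ler_wpM2l ?invr_ge0// ler_sum.
Qed.

(** As [kappa >= 1] and [psi >= 0], dropping [kappa] weakens the bound and makes it uniform in
    [w]. *)
Lemma condH3_coercive (R : realType) (Z : ptopologicalType)
    (pi0 : probability (borelType Z) R) (p : nat) (h : 'rV[R]_p -> Z -> R) :
  condH3 pi0 h -> exists psi : Z -> R,
    [/\ coercive psi, forall z, 0 <= psi z & forall w z, h w z <= - psi z].
Proof.
move=> [eta [psi [kappa [_ [_ psic psi0] [_ k1] _ hk]]]].
exists psi; split => // w z; apply: (le_trans (hk w z)).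
by rewrite mulNr lerN2 ler_peMl.
Qed.

Lemma condD2_dominated (R : realType) (Z : ptopologicalType)
    (pi0 : probability (borelType Z) R) (p : nat) (h : 'rV[R]_p -> Z -> R) :
  condD2 pi0 h -> exists Psi : Z -> R,
    [/\ continuous Psi, forall z, 0 <= Psi z,
      forall w : 'rV[R]_p, exists2 c, 0 <= c &
        \forall y \near w, forall z, `|grad (h ^~ z) y| <= c * Psi z &
      pi0.-integrable setT (EFin \o Psi)].
Proof.
move=> [eta [Psi [C [eta0 [Psic Psi0] [Cb C1] PsiI hC]]]].
exists Psi; split => //.
  move=> w; have /ex_bound[c cP] := Cb w.
  exists `|c| => //; apply: filterS cP => y yc z.
  rewrite (le_trans (norm_le_enorm _))// (le_trans (hC y z))// ler_wpM2r//.
  by rewrite (le_trans (ler_norm _))// (le_trans yc)// ler_norm.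
have mPsi : measurable_fun [set: borelType Z] (Psi : borelType Z -> R).
  exact: continuous_measurable_borel.
have mPsi1 : measurable_fun [set: borelType Z] (fun z : borelType Z => Psi z `^
  (1 + eta)).
  exact: (measurableT_comp (measurable_powR (1 + eta)) mPsi).
have iPsi1 : pi0.-integrable setT (fun z => (Psi z `^ (1 + eta))%:E).
  apply/integrableP; split; first exact/measurable_EFinP.
  apply: le_lt_trans PsiI; rewrite le_eqVlt; apply/orP; left; apply/eqP.
  by apply: eq_integral => z _; rewrite /= ger0_norm ?powR_ge0.
have i1 : pi0.-integrable setT (EFin \o cst (1 : R)).
  exact: finite_measure_integrable_cst.
have := @integrableD _ _ _ pi0 setT measurableT _ _ i1 iPsi1.
apply: le_integrable => //; first exact/measurable_EFinP.
move=> z _; rewrite /= lee_fin !ger0_norm ?addr_ge0 ?powR_ge0//.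
(* [Psi <= 1 + Psi^(1 + eta)] in both cases, so the moment condition yields integrability of
   [Psi]. *)
have [P1|/ltW P1] := leP (Psi z) 1.
  by rewrite (le_trans P1)// lerDl powR_ge0.
rewrite -[leLHS]powRr1// (@le_trans _ _ (Psi z `^ (1 + eta)))// ?lerDr//.
by rewrite ler_powR// lerDl ltW.
Qed.

Theorem corollary3p1 (R : realType) (Z : ptopologicalType)
    (pi0 : probability (borelType Z) R) (n p : nat)
    (h : 'I_n -> 'rV[R]_p -> Z -> R)
    (Zpolish : polish R Z)
    (n_gt0 : (0 < n)%N)
    (hH1 : condH1 pi0)
    (hH2 : forall i, condH2 (h i))
    (hH3 : forall i, condH3 pi0 (h i))
    (hD1 : forall i, condD1 (h i))
    (hD2 : forall i, condD2 pi0 (h i))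
    (K : set 'rV[R]_p) (cK : compact K) :
  let F := average (fun i => hardmax (h i)) in
  let Fs (beta : R) := average (fun i => softmax pi0 (h i) beta) in
  excess (graph_on K (fun w => [set grad (Fs beta) w]))
         (graph_on K (clarke F)) @[beta --> 0^'+] --> 0%E.
Proof.
move=> F Fs.
have /choice[psi /all_and3[psic psi0 hpsi]] := fun i => condH3_coercive (hH3 i).
have /choice[Psi /all_and4[Psic Psi0 gPsi PsiI]] := fun i => condD2_dominated
  (hD2 i).
have hdiff i : forall z w, differentiable (h i ^~ z) w by have [] := hD1 i.
have gcont i : continuous (fun x : 'rV[R]_p * Z => grad (h i ^~ x.2) x.1).
  by have [] := hD1 i.
pose G i := hardmax_subgrad (hH2 i) (psic i) (hpsi i).
have dSmax b i y v : 0 < b -> derivable (softmax pi0 (h i) b) y v.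
  move=> b0; have [] // := is_derive_softmax hH1 (hH2 i) (psi0 i) (hpsi i)
    (hdiff i) (gcont i) (Psi0 i) (gPsi i) (PsiI i) y v b0.
(* The remaining goals are the six assumptions on [F] and its smoothings, each deduced by averaging
   over [i]. *)
apply: (@excess_smoothing R p F (vaverage G)) => //.
- move=> w; have /choice[L LP] := fun i => hardmax_subgrad_bounded (hH2 i)
    (psic i) (hpsi i) (Psic i) (gPsi i) w.
  exists (n%:R^-1 * \sum_(i < n) L i).
  apply: filterS (filter_forall _ LP) => y; exact: norm_vaverage_le.
- move=> w e e0.
  have near_r i : \forall r \near 0^'+, approx_subgrad (hardmax (h i)) (G i) w
    r e.
    have [r r0] := hardmax_subgradP (hH2 i) (psic i) (hpsi i) (hdiff i) (gcont
      i) w e0.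
    exact: approx_subgrad_near.
  have [r [r0 rP]] := filter_ex (filterI (nbhs_right_gt (0 : R)) (filter_forall
    _ near_r)).
  by exists r => //; exact: approx_subgrad_average.
- move=> w; apply: grad_average_bounded => [b i y v b0|i]; first exact: dSmax.
  exact: (softmax_grad_bounded hH1 (hH2 i) (psic i) (psi0 i) (hpsi i) (hdiff i)
    (gcont i) (Psic i) (Psi0 i) (gPsi i) (PsiI i) w).
- move=> w e e0.
  have near_r i : \forall r \near (0 : R)^'+, \forall b \near (0 : R)^'+,
      approx_subgrad (softmax pi0 (h i) b) (grad (softmax pi0 (h i) b)) w r e.
    have [r r0 rP] := softmax_subgrad hH1 (hH2 i) (psic i)
      (psi0 i) (hpsi i) (hdiff i) (gcont i) (Psi0 i) (gPsi i) (PsiI i) w e0.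
    apply: filterS (nbhs_right_lt r0) => s sr; apply: filterS rP => b bP x y xs
      ys.
    by apply: bP; [exact: lt_trans sr|exact: lt_trans sr].
  have [r [r0 rP]] := filter_ex (filterI (nbhs_right_gt (0 : R)) (filter_forall
    _ near_r)).
  exists r => //.
  apply: filterS (filterI (nbhs_right_gt (0 : R)) (filter_forall _ rP)) => b
    [b0 bP].
  move=> x y xw yw; rewrite grad_average => [|i v]; last exact: dSmax.
  exact: (approx_subgrad_average n_gt0 bP).
- move=> b x b0; apply: average_le => i.
  exact: (softmax_le_hardmax hH1 (hH2 i) (psic i) (psi0 i) (hpsi i) (PsiI i)).
- move=> w e e0; apply: average_near_ge => // i.
  exact: (softmax_near_ge hH1 (hH2 i) (psic i) (psi0 i) (hpsi i) (PsiI i) w e0).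
Qed.
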